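(* Let $H=(V,\Delta)$ be a partial Steiner triple system with underlying graph $G$, and suppose there is $v\in V$ such that the set of triples of $H$ not containing $v$ contains no cycle. Then the number of spanning trees of $H$ equals the number of perfect matchings of $G-v$. Furthermore, $H$ is 3-Pfaffian if and only if $G-v$ is Pfaffian.
   Context: A 3-graph is $H=(V,\Delta)$ with $V$ finite and $\Delta\subseteq\binom V3$ (triples). It is a partial Steiner triple system if every pair of vertices lies in at most one triple. Its underlying graph $G$ has vertex set $V$ and an edge $ab$ whenever some triple contains $\{a,b\}$; $G-v$ denotes $G$ with vertex $v$ (and incident edges) removed. A cycle is a sequence $a_0,t_1,a_1,\dots,t_\ell,a_\ell=a_0$, $\ell\ge2$, with distinct vertices $a_0,\dots,a_{\ell-1}$, distinct triples $t_i$, and $a_{i-1},a_i\in t_i$. A spanning tree of $H$ is a set of triples containing no cycle, covering $V$, and connected (any two vertices joined by a path $a_0,t_1,a_1,\dots,t_\ell,a_\ell$ of distinct vertices and distinct triples of $T$ with $a_{i-1},a_i\in t_i$). Identify $V$ with $[N]$ via a linear order. A triple orientation $\omega$ assigns each triple $t=\{i,j,k\}$ a 3-cycle $\sigma(t,\omega)\in\{(i\,j\,k),(j\,i\,k)\}$. For a spanning tree $T$, $\prod_{t\in T}\sigma(t,\omega)$ is an $N$-cycle $(s(1)\cdots s(N))$ and $\mathrm{sgn}(T,\omega)$ is the sign of $s$ (well defined). $H$ is 3-Pfaffian if some $\omega$ makes $\mathrm{sgn}(T,\omega)$ constant over all spanning trees. For a graph with linearly ordered vertices, a perfect matching $M$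 has sign $(-1)^{\#\{i<j<k<l:\{i,k\},\{j,l\}\in M\}}$; an edge orientation is Pfaffian if $\mathrm{sgn}(M)(-1)^{\#\{ij\in M:i<j,\ j\to i\}}$ is constant over all perfect matchings; a graph is Pfaffian if it has a Pfaffian orientation.
   Formalization: A spanning tree is required to cover V only when H has more than one vertex; for a single vertex the empty set of triples counts as a spanning tree, since otherwise there would be 0 spanning trees but one (empty) perfect matching of G-v. *)

(* Defs.v *)
From HB Require Import structures.
From mathcomp Require Import all_boot all_order all_algebra all_fingroup.

Set Implicit Arguments.
Unset Strict Implicit.
Unset Printing Implicit Defensive.

Import GroupScope.

(* The vertex set V, with its linear order, is 'I_N; a 3-graph is given by    *)
(* its set D of triples.                                                      *)

Section ThreeGraphs.

Variable N : nat.
Notation V := 'I_N.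
Notation triple := {set V}.
Implicit Types (D T : {set triple}) (x y : V) (p : seq (triple * V)).

Definition is_3graph D := [forall t in D, #|t| == 3].

Definition partial_steiner D :=
  is_3graph D /\
  forall x y t1 t2, x != y -> t1 \in D -> t2 \in D ->
    x \in t1 -> y \in t1 -> x \in t2 -> y \in t2 -> t1 = t2.

(* The sequence a_0, t_1, a_1, ..., t_l, a_l is encoded by its first vertex   *)
(* a_0 and the list p = [:: (t_1, a_1); ...; (t_l, a_l)].                     *)
Fixpoint hwalk T x p : bool :=
  if p is (t, y) :: p' then [&& t \in T, x \in t, y \in t & hwalk T y p']
  else true.

(* Since a_l = a_0, distinctness of a_0, ..., a_(l-1) is that of a_1, ..., a_l. *)
Definition hcycle T x p :=
  [&& 2 <= size p, hwalk T x p, last x (unzip2 p) == x,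
      uniq (unzip2 p) & uniq (unzip1 p)].

Definition hpath T x y p :=
  [&& hwalk T x p, last x (unzip2 p) == y,
      uniq (x :: unzip2 p) & uniq (unzip1 p)].

(* The bound on the length makes these decidable; it loses nothing, as the    *)
(* vertices are distinct (hacyclicP and hconnectedP below).                   *)
Definition hacyclic T :=
  [forall l : 'I_N.+1, forall x, forall p : l.-tuple (triple * V),
     ~~ hcycle T x p].

Definition hconnected T :=
  [forall x, forall y, exists l : 'I_N.+1,
     exists p : l.-tuple (triple * V), hpath T x y p].

Lemma hacyclicP T : reflect (forall x p, ~~ hcycle T x p) (hacyclic T).
Proof.
apply: (iffP forallP) => [H x p | H l]; last first.
  by apply/forallP => x; apply/forallP => p.
apply/negP => Hp.
have lep : size p < N.+1.
  case/and5P: Hp => _ _ _ Hu _.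
  by rewrite ltnS -(size_map snd) -(card_uniqP Hu) -[leqRHS]card_ord max_card.
have /forallP/(_ x)/forallP/(_ (in_tuple p)) := H (Ordinal lep).
by rewrite Hp.
Qed.

Lemma hconnectedP T :
  reflect (forall x y, exists p, hpath T x y p) (hconnected T).
Proof.
apply: (iffP forallP) => [H x y | H x].
  have /forallP/(_ y)/existsP[l /existsP[p Hp]] := H x.
  by exists p.
apply/forallP => y; have [p Hp] := H x y.
have lep : size p < N.+1.
  case/and4P: Hp => _ _ /= /andP[_ Hu] _.
  by rewrite ltnS -(size_map snd) -(card_uniqP Hu) -[leqRHS]card_ord max_card.
by apply/existsP; exists (Ordinal lep); apply/existsP; exists (in_tuple p).
Qed.

(* The guard on the covering condition only matters when V is a single        *)
(* vertex, in which case the empty set of triples is a spanning tree.         *)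
Definition spanning_tree D T :=
  [&& T \subset D, hacyclic T, (1 < N) ==> (cover T == [set: V])
    & hconnected T].

(* The permutation i |-> j |-> k |-> i, for distinct i, j, k. *)
Definition cycle3 (i j k : V) : {perm V} := tperm i j * tperm i k.

(* An orientation omega is given by the map t |-> sigma(t, omega). *)
Definition triple_orientation D (w : triple -> {perm V}) :=
  forall i j k, uniq [:: i; j; k] -> [set i; j; k] \in D ->
    w [set i; j; k] = cycle3 i j k \/ w [set i; j; k] = cycle3 j i k.

(* c is the N-cycle (s(1) ... s(N)); ordS is the cyclic successor on 'I_N. *)
Definition cycle_notation (c s : {perm V}) := [forall i, c (s i) == s (ordS i)].

(* The product is taken in the order of enum T; for a spanning tree neither   *)
(* this order nor the choice of s affects the sign. The value 0 is never      *)
(* taken when T is a spanning tree and w a triple orientation.                *)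
Definition tree_sign (w : triple -> {perm V}) T : int :=
  if [pick s | cycle_notation (\prod_(t in T) w t) s] is Some s
  then ((-1) ^+ odd_perm s)%R else 0%R.

Definition three_pfaffian D :=
  exists w, triple_orientation D w /\
    forall T1 T2, spanning_tree D T1 -> spanning_tree D T2 ->
      tree_sign w T1 = tree_sign w T2.

(* Finite simple graphs on a vertex set inheriting the order of 'I_N. *)
Record ograph := OGraph {
  verts : {set V};
  edges : {set {set V}};
  edgesP : forall e, e \in edges -> e \subset verts /\ #|e| = 2
}.

Lemma underlying_edgesP D e :
  e \in [set e : {set V} | (#|e| == 2) && [exists t in D, e \subset t]] ->
  e \subset [set: V] /\ #|e| = 2.
Proof. by rewrite inE => /andP[/eqP-> _]; rewrite subsetT. Qed.

Definition underlying_graph D := OGraph (@underlying_edgesP D).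

Lemma del_vertex_edgesP (G : ograph) v e :
  e \in [set e in edges G | v \notin e] -> e \subset verts G :\ v /\ #|e| = 2.
Proof. by rewrite inE => /andP[/edgesP[eG e2] ve]; rewrite subsetD1 eG. Qed.

Definition del_vertex (G : ograph) v := OGraph (@del_vertex_edgesP G v).

Definition perfect_matching (G : ograph) (M : {set {set V}}) :=
  (M \subset edges G) && partition M (verts G).

Definition crossings (M : {set {set V}}) : nat :=
  #|[set q : V * V * (V * V) |
      let: ((i, j), (k, l)) := q in
      [&& i < j, j < k, k < l, [set i; k] \in M & [set j; l] \in M]]|.

Definition matching_sign M : int := ((-1) ^+ crossings M)%R.

(* o i j means that the edge ij is directed from i to j. *)
Definition edge_orientation (G : ograph) (o : rel V) :=
  forall i j, [set i; j] \in edges G -> o i j = ~~ o j i.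

Definition backward_edges (o : rel V) (M : {set {set V}}) : nat :=
  #|[set q : V * V |
      let: (i, j) := q in [&& i < j, [set i; j] \in M & o j i]]|.

Definition pfaffian_orientation (G : ograph) (o : rel V) :=
  edge_orientation G o /\
  forall M1 M2, perfect_matching G M1 -> perfect_matching G M2 ->
    (matching_sign M1 * (-1) ^+ backward_edges o M1 =
     matching_sign M2 * (-1) ^+ backward_edges o M2)%R.

Definition pfaffian (G : ograph) := exists o, pfaffian_orientation G o.

End ThreeGraphs.

(* Main.v *)
Require Import Defs.
From mathcomp Require Import all_boot all_order all_algebra all_fingroup.
From mathcomp Require Import zify.

(* Grow a spanning tree of triples from v: each new triple {r, a, b} is glued  *)
(* along one vertex r, and the pairs {a, b} form a perfect matching of G - v.  *)
(* Conversely every edge ab of G lies in a unique triple, so a perfect         *)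
(* matching selects triples; if these could not be grown from v, following     *)
(* third vertices would produce a cycle of triples avoiding v. In the product  *)
(* of the 3-cycles, gluing (r a b) inserts the adjacent block a b into the     *)
(* long cycle, and moving such a block does not change the parity of           *)
(* inversions. Hence the sign of a tree is, up to a global constant, that of   *)
(* the sequence v a_1 b_1 a_2 b_2 ..., i.e., the sign of the matching with     *)
(* respect to the orientations a_i -> b_i. Finally, an orientation of G - v    *)
(* comes from a triple orientation iff it is cyclic on the triples avoiding v, *)
(* which can be achieved by switching at vertices as these triples form a      *)
(* forest.                                                                     *)

Set Implicit Arguments.
Unset Strict Implicit.
Unset Printing Implicit Defensive.

(** Both claims rest on one structure: a list [L] of steps [(r, (a, b))] growing triples from [v],
    which yields the tree [gtriples L] and the matching [gpairs L]. By [tree_grown] every spanning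
    tree arises this way, and by [matching_grown], which uses acyclicity away from [v], so does
    every perfect matching of G - v. [matching_triples] recovers the tree from the matching and is
    injective by [gpairs_inj], so the two counts agree.

    For signs, [tree_cycle] and [tree_sign_inv] turn the sign of a tree into an inversion parity,
    which [inv_parity_crossings] and [backward_parity] express by crossings and backward edges. The
    result, [tree_sign_matching], equates the tree sign with the Pfaffian term of the matching up to
    a factor common to all trees. A triple orientation induces an edge orientation directly; for the
    other direction, [cyclic_switching] makes an edge orientation cyclic on the triples avoiding
    [v]. *)

Lemma connect_map (A B : finType) (e : rel A) (e' : rel B) (h : A -> B) :
  (forall x y, e x y -> connect e' (h x) (h y)) ->
  forall x y, connect e x y -> connect e' (h x) (h y).
Proof.
move=> eh x _ /connectP[p ep ->]; elim: p x ep => [|z p IHp] x /=.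
  by rewrite connect0.
by case/andP=> /eh xz /IHp; apply: connect_trans.
Qed.

Lemma connect_exit (A : finType) (e : rel A) (S : {pred A}) x y :
  connect e x y -> x \in S -> y \notin S ->
  exists u w, [/\ u \in S, w \notin S & e u w].
Proof.
case/connectP=> p ep ->; elim: p x ep => [|z p IHp] x /=.
  by move=> _ ->.
case/andP=> exz ep xS nS; case: (boolP (z \in S)) => zS.
  exact: IHp ep zS nS.
by exists x, z.
Qed.

(** * Connectedness and acyclicity of sets of triples *)

Section Hypergraphs.

Variable N : nat.
Notation V := 'I_N.
Notation triple := {set V}.
Implicit Types (D T : {set triple}) (t e : triple) (x y : V).
Implicit Types (p : seq (triple * V)).

Lemma card_set3 x y z : uniq [:: x; y; z] -> #|[set x; y; z]| = 3.
Proof.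
rewrite /= !inE negb_or andbT => /andP[/andP[xy xz] yz].
by rewrite -setUA cardsU1 !inE negb_or xy xz cards2 yz.
Qed.

Lemma card3E t x y : #|t| = 3 -> x \in t -> y \in t -> x != y ->
  exists z, [/\ z != x, z != y & t = [set x; y; z]].
Proof.
move=> t3 xt yt xy.
have : #|t :\: [set x; y]| == 1.
  rewrite cardsD (setIidPr _) ?cards2 ?xy ?t3 //.
  by apply/subsetP=> z /set2P[]->.
case/cards1P=> z tz; exists z.
have : z \in t :\: [set x; y] by rewrite tz set11.
rewrite !inE negb_or => /andP[/andP[zx zy] zt]; split=> //.
apply/esym/eqP; rewrite eqEcard t3 card_set3 ?andbT; last first.
  by rewrite /= !inE negb_or xy eq_sym zx eq_sym zy.
by apply/subsetP=> u; rewrite !inE -orbA => /or3P[]/eqP->.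
Qed.

Definition hadj T : rel V :=
  [rel x y | [exists t in T, (x \in t) && (y \in t)]].

Lemma hadjP T x y :
  reflect (exists t, [/\ t \in T, x \in t & y \in t]) (hadj T x y).
Proof.
by apply: (iffP exists_inP) => -[t]; [move=> tT /andP[]|case]; exists t => //;
  apply/andP.
Qed.

Lemma hadj_sym T : symmetric (hadj T).
Proof. by move=> x y; apply/hadjP/hadjP=> -[t []]; exists t. Qed.

Lemma connect_hadjC T : connect_sym (hadj T).
Proof. exact/sym_connect_sym/hadj_sym. Qed.

Lemma connect_hadj1 T t x y :
  t \in T -> x \in t -> y \in t -> connect (hadj T) x y.
Proof. by move=> tT xt yt; apply/connect1/hadjP; exists t. Qed.

Lemma connect_hadjS T1 T2 x y : T1 \subset T2 ->
  connect (hadj T1) x y -> connect (hadj T2) x y.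
Proof.
move=> /subsetP sT; apply: (connect_map (h := id)) => {}x {}y /hadjP[t [tT]].
by apply: connect_hadj1; apply: sT.
Qed.

Lemma hwalk_connect T x p : hwalk T x p ->
  connect (hadj T) x (last x (unzip2 p)).
Proof.
elim: p x => [|[t y] p IHp] x /=; first by rewrite connect0.
case/and4P=> tT xt yt /IHp; apply: connect_trans; exact: connect_hadj1 xt yt.
Qed.

Lemma hwalk_cat T x p1 p2 :
  hwalk T x (p1 ++ p2) = hwalk T x p1 && hwalk T (last x (unzip2 p1)) p2.
Proof. by elim: p1 x => [|[t y] p IHp] x //=; rewrite IHp -!andbA. Qed.

Lemma hwalk_mem T x p : hwalk T x p -> {subset unzip1 p <= T}.
Proof.
elim: p x => [|[t y] p IHp] x //= /and4P[tT _ _ /IHp sp] u.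
by rewrite inE => /predU1P[->|/sp].
Qed.

Lemma hwalk_sub T1 T2 x p :
  hwalk T1 x p -> {subset unzip1 p <= T2} -> hwalk T2 x p.
Proof.
elim: p x => [|[t y] p IHp] x //= /and4P[tT -> -> /IHp sp] sT.
by rewrite sT ?mem_head // sp // => u up; rewrite sT // inE up orbT.
Qed.

(** Prepending a step to a path may break distinctness. If the new vertex already occurs, the path
    is cut to start there; if the new triple already occurs, the first step jumps to the end of that
    later use. *)
Lemma connect_hpath T x y : connect (hadj T) x y -> exists p, hpath T x y p.
Proof.
case/connectP=> q eq ->; elim: q x eq => [|z q IHq] x /=.
  by exists [::]; rewrite /hpath /= eqxx.
case/andP=> /hadjP[t [tT xt zt]] /IHq[p {IHq}].
move: (last z q) => w; rewrite /hpath => /and4P[pw /eqP pl pu pt].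
case: (boolP (x \in z :: unzip2 p)) => [|xp].
  rewrite inE => /predU1P[->|/mapP[[t' x'] xp /= xx']].
    by exists p; rewrite pw pl eqxx pu.
  case/splitPr: xp pw pl pu pt => p1 p2.
  rewrite hwalk_cat /unzip2 /unzip1 !map_cat last_cat -cat_cons !cat_uniq -xx'
    /=.
  case/and5P=> _ _ _ _ pw pl /and3P[_ _ /andP[xp2 up2]] /and4P[_ _ _ ut].
  by exists p2; rewrite pw pl eqxx /= xp2 up2 ut.
case: (boolP (t \in unzip1 p)) => [/mapP[[t' x'] xtp /= tt']|tp].
  case/splitPr: xtp pw pl pu pt xp => p1 p2.
  rewrite hwalk_cat /unzip2 /unzip1 !map_cat last_cat -cat_cons !cat_uniq -tt'
    /=.
  case/and5P=> _ _ _ xt' pw pl /and3P[_ _ up2] /and3P[_ _ ut].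
  rewrite inE mem_cat negb_or => /andP[_]; rewrite negb_or => /andP[_ xp2].
  by exists ((t, x') :: p2); rewrite /= tT xt xt' pw pl eqxx xp2 /=; apply/andP.
exists ((t, z) :: p); rewrite /= tT xt zt pw pl eqxx.
by rewrite tp pt; move: pu xp => /= -> ->.
Qed.

Lemma hconnectedE T :
  reflect (forall x y, connect (hadj T) x y) (hconnected T).
Proof.
apply: (iffP (hconnectedP T)) => H x y; last exact: connect_hpath.
by have [p /and4P[/hwalk_connect pw /eqP<-]] := H x y.
Qed.

(** Bridge form of acyclicity: a path outside [t] between two of its vertices is closed to a cycle
    by [t], and removing the first triple of a cycle leaves such a path. *)
Lemma hacyclicE T :
  reflect (forall t x y, t \in T -> x \in t -> y \in t ->
             connect (hadj (T :\ t)) x y -> x = y)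
          (hacyclic T).
Proof.
apply: (iffP (hacyclicP T)) => H.
  move=> t x y tT xt yt /connect_hpath[p /and4P[pw /eqP pl pu pt]].
  apply/eqP; case: eqP => // /eqP xy.
  have /negP[] := H y ((t, x) :: p); apply/and5P; split=> /=.
  - by case: p pl {pw pu pt} => //= xy'; rewrite xy' eqxx in xy.
  - rewrite tT yt xt /=; apply: (hwalk_sub pw) => u /(hwalk_mem pw).
    by rewrite inE => /andP[].
  - by rewrite pl.
  - exact: pu.
  - rewrite pt andbT; apply/negP=> /(hwalk_mem pw).
    by rewrite !inE eqxx.
move=> x [|[t y] p]; rewrite /hcycle //=.
apply/negP=> /and5P[p0 /and4P[tT xt yt pw] /eqP pl /andP[yp pu] /andP[tp pt]].
have yx : connect (hadj (T :\ t)) y x.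
  rewrite -pl; apply: hwalk_connect; apply: (hwalk_sub pw) => u up.
  rewrite in_setD1 (hwalk_mem pw up) andbT; apply: contraNneq tp => <- //.
(* A cycle has at least two triples, so the rest [p] is nonempty and ends at [x]; with [y = x] this
   vertex is repeated. *)
have := H t y x tT yt xt yx => eyx; rewrite eyx in yp.
case: p p0 pl yp {pw pu tp pt yx} => //= -[t' y'] p _ /= pl.
by rewrite -{1}pl mem_last.
Qed.

Lemma hacyclicS T1 T2 : T1 \subset T2 -> hacyclic T2 -> hacyclic T1.
Proof.
move=> s12 /hacyclicE H; apply/hacyclicE=> t x y tT xt yt c.
by apply: (H t x y (subsetP s12 _ tT)) => //; apply: connect_hadjS c;
  apply: setSD.
Qed.

End Hypergraphs.

(** * Growing trees of triples from a root *)

Section Growth.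

Variables (N : nat) (v : 'I_N).
Notation V := 'I_N.
Notation triple := {set V}.
Implicit Types (D T : {set triple}) (t e : triple) (x y : V).
Implicit Types (M : {set {set V}}) (s : V * (V * V)) (L : seq (V * (V * V))).

Definition unroll (ps : seq (V * V)) : seq V :=
  flatten [seq [:: c.1; c.2] | c <- ps].

Definition gverts L : seq V := v :: unroll (unzip2 L).
Definition gtriple s : triple := [set s.1; s.2.1; s.2.2].
Definition gpair s : {set V} := [set s.2.1; s.2.2].
Definition gtriples L : {set triple} := [set t in map gtriple L].
Definition gpairs L : {set {set V}} := [set e in map gpair L].

(* A hypertree rooted at [v]: each step [(r, (a, b))] glues the triple        *)
(* [{r, a, b}] along [r] to the previous ones; the newest step comes first.   *)
Fixpoint grown L : bool :=
  if L is (r, (a, b)) :: L' then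
    [&& r \in gverts L', a \notin gverts L', b \notin gverts L', a != b
      & grown L']
  else true.

Definition spans L := forall x, x \in gverts L.

Lemma gverts_cons r a b L x :
  (x \in gverts ((r, (a, b)) :: L)) = [|| x == a, x == b | x \in gverts L].
Proof. by rewrite /gverts /= !inE orbCA; congr (_ || _); rewrite orbCA. Qed.

Lemma in_gtriple s x :
  (x \in gtriple s) = [|| x == s.1, x == s.2.1 | x == s.2.2].
Proof. by rewrite !inE -orbA. Qed.

Lemma gverts_root L : v \in gverts L.
Proof. exact: mem_head. Qed.

Lemma gtriples_cons s L : gtriples (s :: L) = gtriple s |: gtriples L.
Proof. by apply/setP=> t; rewrite !inE. Qed.

Lemma gverts_uniq L : grown L -> uniq (gverts L).
Proof.
elim: L => [|[r [a b]] L IHL] //= /and5P[_ aL bL ab /IHL/andP[vL uL]].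
move: aL bL; rewrite /gverts /= !inE !negb_or => /andP[av aL] /andP[bv bL].
by rewrite ab aL bL eq_sym av eq_sym bv /=; apply/andP.
Qed.

Lemma grown_uniq3 r a b L : grown ((r, (a, b)) :: L) -> uniq [:: r; a; b].
Proof.
case/and5P=> rL aL bL ab _; rewrite /= !inE ab negb_or !andbT.
by apply/andP; split; [apply: contraNneq aL | apply: contraNneq bL] => <-.
Qed.

Lemma gtriple_sub L s x :
  grown L -> s \in L -> x \in gtriple s -> x \in gverts L.
Proof.
elim: L => [|[r [a b]] L IHL] // /and5P[rL _ _ _ gL].
rewrite gverts_cons inE => /predU1P[->|sL xs]; last by rewrite IHL ?orbT.
by rewrite in_gtriple => /or3P[]/eqP->; rewrite ?eqxx ?rL ?orbT.
Qed.

Lemma gtriples_sub L t x :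
  grown L -> t \in gtriples L -> x \in t -> x \in gverts L.
Proof. by move=> gL; rewrite inE => /mapP[s sL ->]; apply: gtriple_sub. Qed.

Lemma grown_connect_root L x :
  grown L -> x \in gverts L -> connect (hadj (gtriples L)) v x.
Proof.
elim: L x => [|[r [a b]] L IHL] x.
  by move=> _; rewrite inE => /eqP->; rewrite connect0.
case/and5P=> rL aL bL ab gL; rewrite gverts_cons gtriples_cons orbA.
have sL := subsetUr [set gtriple (r, (a, b))] (gtriples L).
case/orP=> [xab|]; last by move/(IHL _ gL); apply: connect_hadjS.
apply: (connect_trans (connect_hadjS sL (IHL r gL rL))).
apply: (@connect_hadj1 _ _ (gtriple (r, (a, b)))); rewrite ?setU11 //.
  by rewrite in_gtriple eqxx.
by rewrite in_gtriple xab orbT.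
Qed.

Lemma grown_connect L x y :
  grown L -> x \in gverts L -> y \in gverts L ->
  connect (hadj (gtriples L)) x y.
Proof.
move=> gL /(grown_connect_root gL); rewrite connect_hadjC => xL.
by move/(grown_connect_root gL); apply: connect_trans.
Qed.

Lemma connect_isolated T x y :
  (forall t, t \in T -> x \notin t) -> connect (hadj T) x y -> x = y.
Proof.
move=> isoT /connectP[[|z p] //=]; case/andP=> /hadjP[t [/isoT/negP]] //.
Qed.

(** The new vertices [a], [b] lie in no older triple, so without the new triple they are isolated.
    For an older triple, contracting [a] and [b] to [r] sends walks to walks in the older
    triples. *)
Lemma grown_acyclic L : grown L -> hacyclic (gtriples L).
Proof.
elim: L => [|[r [a b]] L IHL] gL.
  by apply/hacyclicE=> t x y; rewrite inE.
have /and5P[rL aL bL ab gL'] := gL; move: (IHL gL') => /hacyclicE acL.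
rewrite gtriples_cons; set t := gtriple _.
have iso x : x \notin gverts L -> forall t', t' \in gtriples L -> x \notin t'.
  by move=> xL t' t'L; apply: contra xL; apply: gtriples_sub t'L.
have tL : t \notin gtriples L.
  by apply/negP=> /(iso _ aL)/negP[]; rewrite !inE /= eqxx orbT.
apply/hacyclicE=> t' x y; case: (eqVneq t' t) => [->|t't] t'L xt yt.
  rewrite setU1K // => cxy.
  case: (boolP (x \in gverts L)) => xL; last exact: connect_isolated (iso x xL)
    cxy.
  case: (boolP (y \in gverts L)) => yL; last first.
    by rewrite connect_hadjC in cxy; rewrite (connect_isolated (iso y yL) cxy).
  have rt z : z \in t -> z \in gverts L -> z = r.
    by rewrite in_gtriple => /or3P[]/eqP-> //;
      rewrite ?(negbTE aL) ?(negbTE bL).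
  by rewrite (rt x xt xL) (rt y yt yL).
case/setU1P: t'L => [t'E|t'L]; first by rewrite t'E eqxx in t't.
pose h z := if (z == a) || (z == b) then r else z.
have hL z : z \in gverts L -> h z = z.
  rewrite /h; case: eqP => [->|_]; first by rewrite (negbTE aL).
  by case: eqP => [->|_] //; rewrite (negbTE bL).
move=> cxy; apply: (acL t' x y t'L xt yt).
rewrite -(hL x) ?(gtriples_sub gL' t'L) // -(hL y) ?(gtriples_sub gL' t'L) //.
move: cxy; apply: connect_map => {xt yt}x {}y /hadjP[u [uL xu yu]].
have /setD1P[ut' /setU1P[uE|{}uL]] := uL; last first.
  by rewrite !hL ?(gtriples_sub gL' uL) //; apply: (@connect_hadj1 _ _ u);
     rewrite // in_setD1 ut'.
have ht z : z \in t -> h z = r.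
  by rewrite in_gtriple /h => /or3P[]/eqP->; rewrite ?eqxx ?orbT //; case: ifP.
by rewrite !ht ?connect0 // -uE.
Qed.

Lemma grown_size L : grown L -> size L < N.
Proof.
move=> /gverts_uniq/card_uniqP uL.
have := max_card (mem (gverts L)); rewrite uL card_ord /=; apply: leq_ltn_trans.
by elim: L {uL} => //= -[r [a b]] L; rewrite /= !ltnS => /leq_trans->.
Qed.

(** Greedy growth under the invariant [P] must stop, since a grown list has fewer than [N] steps. It
    serves both trees and matchings. *)
Lemma grow_until (P : seq (V * (V * V)) -> Prop) :
  P [::] -> (forall L, P L -> grown L) ->
  (forall L x, P L -> x \notin gverts L -> exists s, P (s :: L)) ->
  exists L, P L /\ spans L.
Proof.
move=> P0 Pg Pstep; suff IH n : exists L, P L /\ (spans L \/ size L = n).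
  have [L [PL [|sL]]] := IH N; first by exists L.
  by have := grown_size (Pg _ PL); rewrite sL ltnn.
elim: n => [|n [L [PL [fL|sL]]]]; first by exists [::]; split=> //; right.
  by exists L; split=> //; left.
case: (boolP [forall x, x \in gverts L]) => [/forallP fL|].
  by exists L; split=> //; left.
by rewrite negb_forall => /existsP[x /(Pstep L x PL)[s Ps]]; exists (s :: L);
   split=> //; right; rewrite /= sL.
Qed.

(** Connectedness gives a triple of [T] leaving the grown vertex set; acyclicity forces it to meet
    that set in one vertex, so it can be glued there. *)
Lemma tree_grown T : (forall t, t \in T -> #|t| = 3) ->
  hacyclic T -> hconnected T ->
  exists L, [/\ grown L, spans L & gtriples L = T].
Proof.
move=> T3 /hacyclicE acT /hconnectedE cT.
pose P L := grown L /\ gtriples L \subset T.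
have [||L x [gL LT] xL|L [[gL LT] fL]] := @grow_until P.
- by split=> //; apply/subsetP=> t; rewrite inE.
- by move=> L [].
- have [u [w [uL wL /hadjP[t [tT ut wt]]]]] :=
    connect_exit (cT v x) (gverts_root L) xL.
  have uw : u != w by apply: contraNneq wL => <-.
  have [z [zu zw tE]] := card3E (T3 t tT) ut wt uw.
  exists (u, (w, z)); split; last by rewrite gtriples_cons subUset LT sub1set
    /gtriple -tE tT.
  rewrite /= uL wL gL eq_sym zw !andbT /=; apply/negP=> zL.
  have zt : z \in t by rewrite tE !inE eqxx orbT.
  case/eqP: zu; apply/esym/(acT t u z tT ut zt).
  apply: connect_hadjS (grown_connect gL uL zL).
  rewrite subsetD1 LT /=; apply: contra wL => tL; exact: gtriples_sub tL wt.
(* Once all vertices are reached, a further triple of [T] would have two vertices connected without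
   it. *)
- exists L; split=> //; apply/eqP; rewrite eqEsubset LT; apply/subsetP=> t tT.
  apply/idPn=> tL; have /card_gt1P[x [y [xt yt /eqP[]]]] :
    1 < #|t| by rewrite T3.
  apply/(acT t x y tT xt yt)/(connect_hadjS _ (grown_connect gL (fL x) (fL y))).
  by rewrite subsetD1 LT.
Qed.

Lemma grown_spanning D L : grown L -> spans L -> gtriples L \subset D ->
  spanning_tree D (gtriples L).
Proof.
move=> gL fL LD; have cL x y := grown_connect gL (fL x) (fL y).
rewrite /spanning_tree LD grown_acyclic //=; apply/andP; split;
  last exact/hconnectedE.
apply/implyP=> N1; apply/eqP/setP=> x; rewrite inE.
(* A walk from [x] to a second vertex starts with a triple covering [x]. *)
have [y yx] : exists y, y != x.
  apply/existsP; apply: contraT; rewrite negb_exists => /forallP nx.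
  have : #|V| <= 1 by apply/fintype_le1P => y z;
    rewrite (eqP (negbNE (nx y))) (eqP (negbNE (nx z))).
  by rewrite card_ord leqNgt N1.
have /connectP[[|z p] /= ep yE] := cL x y; first by rewrite yE eqxx in yx.
by have /andP[/hadjP[t [tL xt _]] _] := ep; apply/bigcupP; exists t.
Qed.

Lemma spanning_grown D T : is_3graph D -> spanning_tree D T ->
  exists L, [/\ grown L, spans L & gtriples L = T].
Proof.
move=> /forall_inP D3 /and4P[/subsetP TD acT _ cT]; apply: tree_grown => //.
by move=> t /TD/D3/eqP.
Qed.

End Growth.

Arguments gtriple {N} s.
Arguments gpair {N} s.

(** * Spanning trees and perfect matchings *)

Section Matchings.

Variables (N : nat) (D : {set {set 'I_N}}) (v : 'I_N).
Hypothesis hD : partial_steiner D.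
Notation V := 'I_N.
Notation G := (del_vertex (underlying_graph D) v).
Implicit Types (T : {set {set V}}) (t e : {set V}) (x y : V).
Implicit Types (M : {set {set V}}) (s : V * (V * V)) (L : seq (V * (V * V))).

Lemma card_triple t : t \in D -> #|t| = 3.
Proof. by have [/forall_inP D3 _] := hD => /D3/eqP. Qed.

Lemma in_edges e : (e \in edges G) =
  [&& v \notin e, #|e| == 2 & [exists t in D, e \subset t]].
Proof. by rewrite !inE andbC. Qed.

Lemma perfect_matchingP M :
  perfect_matching G M <->
  [/\ M \subset edges G, forall x, x != v -> exists2 e, e \in M & x \in e
    & forall e e' x, e \in M -> e' \in M -> x \in e -> x \in e' -> e = e'].
Proof.
rewrite /perfect_matching /partition; split.
  case/and4P=> MG /eqP cM /trivIsetP tM _;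
    split=> // [x xv|e e' x eM e'M xe xe'].
    have : x \in cover M by rewrite cM !inE xv.
    by case/bigcupP=> e; exists e.
  apply/eqP/idPn=> /(tM e e' eM e'M)/pred0P/(_ x).
  by rewrite /= xe xe'.
case=> MG cM uM; rewrite MG /=; apply/and3P; split.
- apply/eqP/setP=> x; rewrite !inE andbT;
  apply/bigcupP/idP => [[e eM xe]|/cM[e]].
    have := subsetP MG e eM; rewrite in_edges => /andP[ve _].
    by apply: contraNneq ve => <-.
  by exists e.
- apply/trivIsetP=> e e' eM e'M; apply: contraR => /pred0Pn[x /andP[xe xe']].
  by rewrite (uM e e' x).
- by apply/negP=> /(subsetP MG); rewrite in_edges cards0 andbF.
Qed.

Lemma triple_edge_inj t t' e : t \in D -> t' \in D -> #|e| = 2 ->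
  e \subset t -> e \subset t' -> t = t'.
Proof.
have [_ D1] := hD => tD t'D /eqP/cards2P[x [y [xy ->]]].
by rewrite !subUset !sub1set => /andP[xt yt] /andP[xt' yt']; apply: (D1 x y).
Qed.

(** Disjoint pairs would need four vertices. *)
Lemma triple_edges_meet t e e' : #|t| = 3 -> #|e| = 2 -> #|e'| = 2 ->
  e \subset t -> e' \subset t -> exists2 x, x \in e & x \in e'.
Proof.
move=> t3 e2 e'2 et e't; apply/exists_inP; apply: contraT;
  rewrite negb_exists_in => /forall_inP ne.
have /subset_leq_card : e :|: e' \subset t by rewrite subUset et.
rewrite cardsU t3 e2 e'2; suff -> : e :&: e' = set0 by rewrite cards0.
by apply/setP=> x; rewrite !inE; apply/negbTE/andP=> -[/ne/negP].
Qed.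

Definition matching_triples M := [set t in D | [exists e in M, e \subset t]].

Lemma gpair_sub s : gpair s \subset gtriple s.
Proof. by rewrite /gtriple -setUA subsetUr. Qed.

Lemma gtriple_in L s : gtriples L \subset D -> s \in L -> gtriple s \in D.
Proof. by move=> LD sL; apply: (subsetP LD); rewrite inE map_f. Qed.

Lemma grown_step_pair L s : grown v L -> s \in L ->
  [/\ s.2.1 != s.2.2, v != s.2.1 & v != s.2.2].
Proof.
elim: L => [|[r [a b]] L IHL] // /and5P[_ aL bL ab gL]; rewrite inE.
case/predU1P=> [->|/IHL]; last exact.
by split=> //=; [apply: contraNneq aL | apply: contraNneq bL] => <-;
  apply: gverts_root.
Qed.

Lemma gverts_pair L x : x \in gverts v L -> x != v ->
  exists2 s, s \in L & x \in gpair s.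
Proof.
elim: L => [|[r [a b]] L IHL]; first by rewrite inE => /eqP->; rewrite eqxx.
rewrite gverts_cons orbA => /orP[xab _|/IHL{}IHL /IHL[s sL xs]].
  by exists (r, (a, b)); rewrite ?mem_head // !inE.
by exists s => //; rewrite inE sL orbT.
Qed.

Lemma gpair_disjoint L s s' x : grown v L -> s \in L -> s' \in L ->
  x \in gpair s -> x \in gpair s' -> s = s'.
Proof.
elim: L => [|[r [a b]] L IHL] // /and5P[_ aL bL _ gL].
have sub s1 : s1 \in L -> x \in gpair s1 -> x \notin gpair (r, (a, b)).
  move=> sL /(subsetP (gpair_sub s1))/(gtriple_sub gL sL) xL.
  by rewrite !inE /=; apply/negP=> /orP[]/eqP xE; rewrite -xE xL in aL bL.
rewrite !in_cons => /predU1P[->|sL] /predU1P[->|s'L] //.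
- by move=> xs /(sub _ s'L); rewrite xs.
- by move=> /(sub _ sL)/negbTE->.
- exact: IHL.
Qed.

Lemma gpairs_matching L : grown v L -> spans v L -> gtriples L \subset D ->
  perfect_matching G (gpairs L).
Proof.
move=> gL fL LD; apply/perfect_matchingP; split.
- apply/subsetP=> e; rewrite inE in_edges => /mapP[s sL ->].
  have [ab va vb] := grown_step_pair gL sL.
  rewrite !inE negb_or va vb cards2 ab /=; apply/exists_inP.
  by exists (gtriple s); rewrite ?gpair_sub // (gtriple_in LD).
- move=> x xv; have [s sL xs] := gverts_pair (fL x) xv.
  by exists (gpair s) => //; rewrite inE map_f.
- move=> e e' x; rewrite !inE => /mapP[s sL ->] /mapP[s' s'L ->] xs xs'.
  by rewrite (gpair_disjoint gL sL s'L xs xs').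
Qed.

Lemma gpair_card L s : grown v L -> s \in L -> #|gpair s| = 2.
Proof. by move=> gL /(grown_step_pair gL)[ab _ _]; rewrite cards2 ab. Qed.

Lemma matching_triples_gpairs L : grown v L -> gtriples L \subset D ->
  matching_triples (gpairs L) = gtriples L.
Proof.
move=> gL LD; apply/setP=> t; rewrite !inE.
apply/andP/mapP=> [[tD /exists_inP[e]]|[s sL ->]].
  rewrite inE => /mapP[s sL ->] st; exists s => //.
  by apply: (triple_edge_inj _ _ (gpair_card gL sL)) => //;
    rewrite ?gpair_sub ?(gtriple_in LD).
split; first exact: gtriple_in LD sL.
by apply/exists_inP; exists (gpair s); rewrite ?gpair_sub // inE map_f.
Qed.

Lemma matching_sub_eq M M' : perfect_matching G M -> perfect_matching G M' ->
  M \subset M' -> M = M'.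
Proof.
case/perfect_matchingP=> _ cM _ /perfect_matchingP[MG' _ uM'] sM.
apply/eqP; rewrite eqEsubset sM; apply/subsetP=> e eM'.
have := subsetP MG' e eM'; rewrite in_edges => /and3P[ve /eqP e2 _].
have /card_gt0P[x xe] : 0 < #|e| by rewrite e2.
have xv : x != v by apply: contraNneq ve => <-.
have [e' e'M xe'] := cM x xv.
by rewrite (uM' e e' x) //; apply: (subsetP sM).
Qed.

(** By induction along the growth, the edge of [M] inside each new triple is its new pair: if it
    contained [r], it would be the older pair covering [r], which meets the new triple in [r]
    alone. *)
Lemma gpairs_inj L M : grown v L -> spans v L -> gtriples L \subset D ->
  perfect_matching G M -> matching_triples M = gtriples L -> M = gpairs L.
Proof.
move=> gL fL LD pM tM; apply/esym/matching_sub_eq => //.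
  exact: gpairs_matching.
have /perfect_matchingP[MG _ uM] := pM.
suff H L' : grown v L' -> {subset L' <= L} -> gpairs L' \subset M by apply: H.
elim: L' => [|s L' IHL] gL' sL'; first by apply/subsetP=> e; rewrite inE.
have sL : s \in L by rewrite sL' ?mem_head.
case: s gL' sL' sL => r [a b] gL' sL' sL.
have /and5P[rL aL bL _ gL1] := gL'.
have {IHL}L'M : gpairs L' \subset M.
  by apply: IHL => // s sL1; rewrite sL' // inE sL1 orbT.
apply/subsetP=> e; rewrite inE => /predU1P[->{e}|eL']; last first.
  by apply: (subsetP L'M); rewrite inE.
have /exists_inP[e eM et] : [exists e in M, e \subset gtriple (r, (a, b))].
  have : gtriple (r, (a, b)) \in matching_triples M by rewrite tM inE map_f.
  by rewrite inE => /andP[].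
have := subsetP MG e eM; rewrite in_edges => /and3P[ve /eqP e2 _].
suff re : r \notin e.
  suff <- : e = gpair (r, (a, b)) by [].
  apply/eqP; rewrite eqEcard e2 (gpair_card gL' (mem_head _ _)) leqnn andbT.
  apply/subsetP=> x xe; have := subsetP et x xe; rewrite in_gtriple !inE.
  by case/orP=> // /eqP /= xr; rewrite -xr xe in re.
apply/negP=> re; have rv : r != v by apply: contraNneq ve => <-.
have [s sL1 rs] := gverts_pair rL rv.
have eE : e = gpair s by apply: (uM e (gpair s) r) => //; apply: (subsetP L'M);
  rewrite inE map_f.
have : e \subset [set r].
  apply/subsetP=> x xe; have := subsetP et x xe; rewrite in_gtriple inE.
  have xL : x \in gverts v L'.
    by apply: (gtriple_sub gL1 sL1); apply: (subsetP (gpair_sub s));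
      rewrite -eE.
  by case/or3P=> // /eqP /= xE; rewrite -xE xL in aL bL.
by move/subset_leq_card; rewrite e2 cards1.
Qed.

Section MatchingGrown.

Hypothesis hv : hacyclic [set t in D | v \notin t].
Variable M : {set {set V}}.
Hypothesis pM : perfect_matching G M.

Lemma mate_triple x : x != v -> exists a r,
  [/\ [set x; a] \in M, [set r; x; a] \in D & uniq [:: r; x; a]].
Proof.
have /perfect_matchingP[MG cM _] := pM.
move=> /cM[e eM xe]; have := subsetP MG e eM; rewrite in_edges.
case/and3P=> ve e2 /exists_inP[t tD et].
have [a eE] : exists a, e = [set x; a].
  have /cards2P[y [z [yz eE]]] := e2; move: xe; rewrite eE => /set2P[]->.
    by exists z.
  by exists y; rewrite setUC.
move: e2 eM et; rewrite eE cards2; case: (eqVneq x a) => // xa _ eM.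
rewrite subUset !sub1set => /andP[xt at_].
have [r [rx ra tE]] := card3E (card_triple tD) xt at_ xa.
exists a, r; split; rewrite ?eM //; first by rewrite -setUA setUC -tE.
by rewrite /= !inE negb_or rx ra xa.
Qed.

(* If no triple of the matching could be glued to [L], the third vertex of    *)
(* the triple matched to [x] would again lie outside [L]; iterating this map  *)
(* closes up into a cycle of triples that avoid [v].                          *)
Lemma matching_extend L x : grown v L -> gpairs L \subset M ->
  x \notin gverts v L ->
  exists s, [/\ grown v (s :: L), gpair s \in M & gtriple s \in D].
Proof.
move=> gL LM xL; have /perfect_matchingP[MG _ uM] := pM.
pose good u ra := [&& [set u; ra.2] \in M, [set ra.1; u; ra.2] \in D
                    & uniq [:: ra.1; u; ra.2]].
(* For [u] other than [v], [m u] is the mate of [u] and [f u] the third vertex of their triple; by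
   [gP] the default [(u, u)] is not reached there. *)
pose g u := odflt (u, u) [pick ra | good u ra].
pose f u := (g u).1; pose m u := (g u).2.
have vout u : u \notin gverts v L -> u != v.
  by apply: contraNneq => ->; apply: gverts_root.
have gP u : u != v -> good u (f u, m u).
  move=> uv; rewrite /f /m /g -surjective_pairing; case: pickP => //= no.
  by have [a [r [h1 h2 h3]]] := mate_triple uv; have := no (r, a);
    rewrite /good h1 h2 h3.
case: (boolP [exists u, (u \notin gverts v L) && (f u \in gverts v L)]) =>
  [|no].
  (* This triple can be glued at [f u]: were [m u] already grown, the pair of [L] covering it would
     be its matching edge and contain [u]. *)
  case/existsP=> u /andP[uL fL]; have /and3P[/= uM' uD uq] := gP u (vout u uL).
  exists (f u, (u, m u)); split; rewrite // /gtriple //.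
  move: uq; rewrite /= fL uL gL !inE => /and3P[_ -> _]; rewrite !andbT /=.
  have := subsetP MG _ uM'; rewrite in_edges !inE negb_or =>
    /andP[/andP[_ vm] _].
  apply: contra uL => mL; have [|s sL ms] := gverts_pair mL;
    first by rewrite eq_sym.
  apply: (gtriple_sub gL sL); apply: (subsetP (gpair_sub s)).
  have <- : [set u; m u] = gpair s.
    by apply: (uM _ _ (m u)); rewrite ?set22 // (subsetP LM) // inE map_f.
  exact: set21.
have fout u : u \notin gverts v L -> f u \notin gverts v L.
  move=> uL; apply: contra no => fL; apply/existsP; exists u; exact/andP.
have iout i u : u \notin gverts v L -> iter i f u \notin gverts v L.
  by move=> uL; elim: i => //= i; apply: fout.
(* The orbit of [x] under [f] stays outside the grown set and is eventually periodic; [z] is a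
   periodic point. *)
have [z zL [k kz]] : exists2 z, z \notin gverts v L & exists k, iter k.+1 f z =
  z.
  have /trajectP[i lt_i] := looping_order f x.
  exists (iter i f x); first exact: iout.
  exists (fingraph.order f x - i).-1; rewrite prednK ?subn_gt0 // -iterD subnK
    //; exact: ltnW.
have /ex_minnP[{kz}k /eqP kz kmin] : exists k, iter k.+1 f z == z by exists k;
  apply/eqP.
set t := [set f z; z; m z].
have /and3P[/= zM zD /= zq] := gP z (vout z zL).
have tF : t \in [set t in D | v \notin t].
  rewrite inE zD /t !inE !negb_or !(eq_sym v) (vout _ zL) (vout _ (fout _ zL))
    /=.
  have := subsetP MG _ zM; rewrite in_edges !inE negb_or => /andP[/andP[_ +] _].
  by rewrite eq_sym.
have /hacyclicE/(_ t (f z) z tF) := hv; rewrite !inE !eqxx orbT.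
(* The triples at the later points of the orbit link [f z] to [z] without [t], against
   acyclicity. *)
suff c : connect (hadj ([set t in D | v \notin t] :\ t)) (f z) z.
  move=> /(_ isT isT c) fz; move: zq; rewrite fz /= !inE eqxx //.
have iz i : 0 < i <= k -> iter i f z != z.
  by case: i => // i /= ik; apply/negP=> /(kmin i); rewrite leqNgt ik.
suff c j : j <= k -> connect (hadj ([set t in D | v \notin t]
  :\ t)) (f z) (iter j f (f z)).
  by rewrite -{2}kz iterSr; apply: c.
elim: j => [|j IHj] jk; first exact: connect0.
apply: connect_trans (IHj (ltnW jk)) _; rewrite iterS -iterSr.
have uL := iout j.+1 z zL; have uz : iter j.+1 f z != z by apply: iz.
set u := iter _ f z in uL uz *.
have /and3P[/= uM' uD /= uq] := gP u (vout u uL).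
apply: (@connect_hadj1 _ _ [set f u; u; m u]); [|by rewrite !inE eqxx ?orbT..].
rewrite !in_setD1 in_set uD; apply/andP; split; last first.
- rewrite !inE !negb_or !(eq_sym v) (vout _ uL) (vout _ (fout _ uL)) /=.
  have := subsetP MG _ uM'; rewrite in_edges !inE negb_or =>
    /andP[/andP[_ +] _].
  by rewrite eq_sym.
(* If the triple at [u] were [t], the two matching edges in it would meet, hence agree. Then
   [f u = f z], and going on around the orbit gives [u = z], against minimality of the period. *)
- apply/eqP=> tE.
  have [y yz yu] : exists2 y, y \in [set z; m z] & y \in [set u; m u].
    apply: (triple_edges_meet (card_triple zD)).
    + move: zM => /(subsetP MG); rewrite in_edges; by case/and3P=> _ /eqP.
    + move: uM' => /(subsetP MG); rewrite in_edges; by case/and3P=> _ /eqP.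
    + by rewrite -setUA subsetUr.
    + by rewrite -/t -tE -setUA subsetUr.
  have eE := uM _ _ y uM' zM yu yz.
  have fE : f u = f z.
    have : f u \in t by rewrite -tE !inE eqxx.
    rewrite /t -setUA in_setU -eE => /orP[/set1P//|].
    by move: uq; rewrite /= !inE => /andP[/negbTE-> ].
  case/eqP: uz; suff -> : u = iter k f (f u) by rewrite fE -iterSr kz.
  by rewrite -iterSr /u -iterD addnC iterD kz.
Qed.

Lemma matching_grown :
  exists L, [/\ grown v L, spans v L, gtriples L \subset D & gpairs L = M].
Proof.
pose P L := [/\ grown v L, gtriples L \subset D & gpairs L \subset M].
have [||L x [gL LD LM] xL|L [[gL LD LM] fL]] := @grow_until N v P.
- by split=> //; apply/subsetP=> t; rewrite inE.
- by move=> L [].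
- have [s [gs sM sD]] := matching_extend gL LM xL.
  exists s; split; rewrite ?gtriples_cons ?subUset ?sub1set ?sD //.
  by apply/subsetP=> e; rewrite inE => /predU1P[->//|eL]; apply: (subsetP LM);
    rewrite inE.
- exists L; split=> //; apply: matching_sub_eq => //; exact: gpairs_matching.
Qed.

End MatchingGrown.

Lemma card_spanning_trees (hv : hacyclic [set t in D | v \notin t]) :
  #|[set T | spanning_tree D T]| = #|[set M | perfect_matching G M]|.
Proof.
rewrite -[RHS](card_in_imset (f := matching_triples)); last first.
  move=> M M'; rewrite !inE => /(matching_grown hv)[L [gL fL LD <-]] pM' tE.
  apply/esym/gpairs_inj => //; by rewrite -tE matching_triples_gpairs.
apply: eq_card => T; rewrite inE; apply/idP/imsetP => [sT|[M]].
  have [L [gL fL LT]] := spanning_grown v (proj1 hD) sT.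
  have LD : gtriples L \subset D by rewrite LT; case/andP: sT.
  exists (gpairs L); first by rewrite inE gpairs_matching.
  by rewrite matching_triples_gpairs.
rewrite inE => /(matching_grown hv)[L [gL fL LD <-]] ->.
by rewrite matching_triples_gpairs //; apply: (grown_spanning gL).
Qed.

End Matchings.

(** * Parity of inversions *)

Fixpoint inv_parity (q : seq nat) : bool :=
  if q is x :: q' then odd (count (ltn^~ x) q') (+) inv_parity q' else false.

(** Each entry passed by the pair changes the parity twice, once for [c] and once for [d]. *)
Lemma inv_parity_pair (A B : seq nat) c d : c \notin A -> d \notin A ->
  inv_parity (A ++ [:: c, d & B]) = inv_parity [:: c, d & A ++ B].
Proof.
elim: A => [|x A IHA] //=; rewrite !inE !negb_or => /andP[cx cA] /andP[dx dA].
rewrite IHA //= !count_cat /= !oddD !oddb.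
have -> : (c < x) = ~~ (x < c) by rewrite -leqNgt ltn_neqAle cx.
have -> : (d < x) = ~~ (x < d) by rewrite -leqNgt ltn_neqAle dx.
move: (odd _) (odd _) (odd _) (odd _) (odd _) (odd _) (d < c) (x < c) (x < d)
  (inv_parity _).
by do 10!case.
Qed.

Lemma inv_parity_map (h : nat -> nat) (q : seq nat) :
  {in q &, {mono h : x y / x < y}} -> inv_parity (map h q) = inv_parity q.
Proof.
elim: q => [|x q IHq] //= hq; rewrite IHq => [|y z yq zq]; last first.
  by apply: hq; rewrite inE ?yq ?zq orbT.
congr (odd _ (+) _); rewrite count_map; apply: eq_in_count => y yq /=.
by apply: hq; rewrite inE ?eqxx ?yq ?orbT.
Qed.

(** Induction by deleting the first value [j] and closing the gap: exactly [j] smaller values follow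
    it, which matches the parity given by [odd_lift_perm]. *)
Lemma odd_perm_inv n (s : 'S_n) :
  odd_perm s = inv_parity [seq val (s i) | i <- enum 'I_n].
Proof.
elim: n s => [|n IHn] s.
  by rewrite (_ : s = 1%g) ?odd_perm1 ?enum_ord0 //; apply/permP=> -[].
pose j := s ord0.
have sj k : {k' | s (lift ord0 k) = lift j k'}.
  case: (unliftP j (s (lift ord0 k))) => [k' ->|]; first by exists k'.
  by move/perm_inj/eqP; rewrite eq_sym (negbTE (neq_lift _ _)).
pose f k := sval (sj k); have fE k : s (lift ord0 k) = lift j (f k) :=
  svalP (sj k).
have f_inj : injective f.
  by move=> k k' fk; apply/(@lift_inj _ ord0)/(@perm_inj _ s); rewrite !fE fk.
pose s' := perm f_inj.
have -> : s = lift_perm ord0 j s'.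
  apply/permP=> i; case: (unliftP ord0 i) => [k ->|->];
    last by rewrite lift_perm_id.
  by rewrite lift_perm_lift fE permE.
rewrite odd_lift_perm enum_ordSl /= lift_perm_id IHn -map_comp.
have E : map ((fun i => nat_of_ord (lift_perm ord0 j s' i)) \o lift ord0) (enum
  'I_n)
       = map (bump j) [seq val (s' i) | i <- enum 'I_n].
  by rewrite -map_comp; apply: eq_map => i /=; rewrite lift_perm_lift.
rewrite E inv_parity_map; last by move=> x y _ _; rewrite /bump; lia.
congr (_ (+) _); congr odd.
have jn : j <= n by rewrite -ltnS.
have -> : count (ltn^~ j) (map (bump j) [seq val (s' i) | i <- enum 'I_n])
        = count (ltn^~ j) [seq val (s' i) | i <- enum 'I_n].
  rewrite count_map; apply: eq_count => x /=; rewrite /bump; lia.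
have -> : count (ltn^~ j) [seq val (s' i) | i <- enum 'I_n]
  = count (ltn^~ j) (iota 0 n).
  apply/seq.permP; rewrite -val_enum_ord (map_comp val); apply: perm_map.
  apply: uniq_perm; rewrite ?enum_uniq ?(map_inj_uniq (@perm_inj _ s'))
    ?enum_uniq //.
  move=> i; rewrite mem_enum; apply/mapP; exists (s'^-1%g i);
    rewrite ?mem_enum //.
  by rewrite permKV.
have := iotaD 0 j (n - j); rewrite subnKC // add0n => ->; rewrite count_cat.
have -> : count (ltn^~ j) (iota 0 j) = j.
  rewrite -[RHS](size_iota 0 j); apply/eqP; rewrite -all_count.
  by apply/allP=> x; rewrite mem_iota.
rewrite (eqP (_ : count _ _ == 0)) ?addn0 //.
rewrite -leqn0 leqNgt -has_count; apply/hasPn=> x; rewrite mem_iota /=; lia.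
Qed.

(** Such a [g] is a power of the rotation [r], and [r] is even because its [N]-th power is trivial
    with [N] odd. *)
Lemma commute_ordS_even N (g : 'S_N) :
  odd N -> (forall i, g (ordS i) = ordS (g i)) -> odd_perm g = false.
Proof.
case: N g => // N g oN gS.
pose r := perm (@ordS_inj N.+1).
have rE n (i : 'I_N.+1) : (r ^+ n)%g i = (i + n) %% N.+1 :> nat.
  elim: n => [|n IHn]; first by rewrite expg0 perm1 addn0 modn_small.
  by rewrite expgSr permM permE /= IHn -addn1 modnDml addn1 addnS.
have r_odd n : odd_perm (r ^+ n)%g = odd n && odd_perm r.
  elim: n => [|n IHn]; first by rewrite expg0 odd_perm1.
  by rewrite expgS odd_permM IHn /=; case: (odd n); case: (odd_perm r).
have r_even : odd_perm r = false.
  rewrite -[LHS]andTb -oN -r_odd (_ : (r ^+ _)%g = 1%g) ?odd_perm1 //.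
  by apply/permP=> i; apply/val_inj; rewrite /= rE perm1 modnDr modn_small.
rewrite (_ : g = r ^+ (g ord0))%g; last first.
  apply/permP=> i; have -> : i = (r ^+ i)%g ord0.
    by apply/val_inj; rewrite [RHS]rE; exact: esym (modn_small (ltn_ord i)).
  rewrite -[RHS]permM -expgnDr addnC expgnDr permM; elim: (i : nat) => [|n IHn].
    by rewrite !expg0 !perm1; apply/val_inj; rewrite [RHS]rE;
      exact: esym (modn_small (ltn_ord _)).
  by rewrite !expgSr !permM [r _]permE gS IHn [RHS]permE.
by rewrite r_odd r_even andbF.
Qed.

(** Two readings of one cycle differ by a permutation commuting with [ordS]. Hence the choice made
    by [pick] in [tree_sign] is harmless. *)
Lemma cycle_notation_odd N (c s s' : 'S_N) :
  odd N -> cycle_notation c s -> cycle_notation c s' ->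
    odd_perm s' = odd_perm s.
Proof.
move=> oN /forallP cs /forallP cs'.
suff : odd_perm (s' * s^-1)%g = false.
  by rewrite odd_permM odd_permV; case: (odd_perm s'); case: (odd_perm s).
apply: commute_ordS_even => // i; rewrite !permM; apply/(@perm_inj _ s).
by rewrite permKV -(eqP (cs' i)) -(eqP (cs _)) permKV.
Qed.

(** * Sign of a spanning tree *)

Lemma eq_in_fpath (A : eqType) (f g : A -> A) x p :
  {in belast x p, f =1 g} -> fpath f x p = fpath g x p.
Proof.
elim: p x => [|y p IHp] x //= fg; rewrite fg ?mem_head // IHp // => z zp.
by rewrite fg // inE zp orbT.
Qed.

Lemma fcycle_insert (A : eqType) (f g : A -> A) q1 q2 x c d :
  fcycle f (q1 ++ x :: q2) -> {in q1 ++ q2, f =1 g} ->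
  g x = c -> g c = d -> g d = f x -> fcycle g (q1 ++ [:: x, c, d & q2]).
Proof.
have rotE h p : fcycle h (q1 ++ p) = fcycle h (p ++ q1).
  by rewrite -(rot_cycle (size q1)) rot_size_cat.
rewrite (rotE f) (rotE g) /= => fq fg gx gc gd.
rewrite gx gc !eqxx /=.
have : {in q2 ++ q1, f =1 g}.
  by move=> z; rewrite mem_cat orbC -mem_cat; apply: fg.
move: fq; set Q := q2 ++ q1.
case E : (rcons Q x) => [|y p]; first by case: (Q) E.
have -> : Q = belast y p by move: E; rewrite lastI => /rcons_inj[].
by move=> /= /andP[/eqP fx fp] fg'; rewrite gd fx eqxx -(eq_in_fpath fg').
Qed.

Section Cycle3.

Variables (N : nat) (i j k : 'I_N).
Hypothesis ijk : uniq [:: i; j; k].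

Lemma cycle3E x :
  cycle3 i j k x = if x == i then j else if x == j then k
                   else if x == k then i else x.
Proof.
move: ijk; rewrite /= !inE negb_or andbT => /andP[/andP[ij ik] jk].
rewrite permM; case: (eqVneq x i) => [->|xi].
  by rewrite tpermL tpermD // eq_sym.
case: (eqVneq x j) => [->|xj]; first by rewrite tpermR tpermL.
rewrite (@tpermD _ i j) 1?eq_sym //; case: (eqVneq x k) => [->|xk].
  by rewrite tpermR.
by rewrite tpermD // eq_sym.
Qed.

End Cycle3.

Lemma cycle3_rot N (i j k : 'I_N) :
  uniq [:: i; j; k] -> cycle3 i j k = cycle3 j k i.
Proof.
move=> ijk; apply/permP=> x; rewrite !cycle3E //; last first.
  by rewrite -[uniq _](rot_uniq 2).
move: ijk; rewrite /= !inE negb_or andbT => /andP[/andP[ij ik] jk].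
case: (eqVneq x i) => [->|_]; first by rewrite (negbTE ij) (negbTE ik).
by [].
Qed.

Lemma prod_perm_fix (I A : finType) (w : I -> {perm A}) (ts : seq I) x :
  {in ts, forall t, w t x = x} -> (\prod_(t <- ts) w t)%g x = x.
Proof.
move=> wx; rewrite big_seq; elim/big_ind: _ => [|p1 p2 p1x p2x|t /wx//].
  by rewrite perm1.
by rewrite permM p1x.
Qed.

Section TreeSign.

Variables (N : nat) (v : 'I_N) (w : {set 'I_N} -> {perm 'I_N}).
Implicit Types (s : 'I_N * ('I_N * 'I_N)) (L : seq ('I_N * ('I_N * 'I_N))).

Definition oriented L :=
  forall s, s \in L -> w (gtriple s) = cycle3 s.1 s.2.1 s.2.2.

Lemma grown_uniq s L : grown v L -> s \in L -> uniq [:: s.1; s.2.1; s.2.2].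
Proof.
elim: L => // -[r [a b]] L IHL gL; rewrite inE => /predU1P[->|sL].
  exact: grown_uniq3 gL.
by apply: IHL => //; case/and5P: gL.
Qed.

Lemma inv_parity_insert (A B : seq 'I_N) (c d : 'I_N) :
  c \notin A -> d \notin A ->
  inv_parity (map val (A ++ [:: c, d & B]))
  = inv_parity (map val [:: c, d & A ++ B]).
Proof.
by move=> cA dA; rewrite map_cat /= inv_parity_pair ?(mem_map val_inj) //=
  map_cat.
Qed.

(* Gluing [{r, a, b}] to a smaller tree inserts the adjacent block [a b] in   *)
(* the long cycle, whatever the position of its 3-cycle in the product.       *)
Lemma tree_cycle L ts : grown v L -> oriented L -> perm_eq ts (map gtriple L) ->
  exists q, [/\ perm_eq q (gverts v L), fcycle (\prod_(t <- ts) w t)%g q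
    & inv_parity (map val q) = inv_parity (map val (gverts v L))].
Proof.
elim: L ts => [|[r [a b]] L IHL] ts gL' oL' pts.
  exists [:: v]; split=> //; move/perm_nilP: pts => ->.
  by rewrite big_nil /= perm1 eqxx.
have /and5P[rL aL bL ab gL] := gL'; have rab := grown_uniq3 gL'.
have oL : oriented L by move=> s sL; apply: oL'; rewrite inE sL orbT.
set t := gtriple (r, (a, b)) in pts.
have tts : t \in ts by rewrite (perm_mem pts) mem_head.
case/splitPr: tts pts => P Q pts.
have pPQ : perm_eq (P ++ Q) (map gtriple L).
  rewrite -(perm_cons t); apply: perm_trans pts.
  by rewrite -[t :: _]/([:: t] ++ P ++ Q) perm_catCA.
have [q [pq cq iq]] := IHL _ gL oL pPQ.
have wfix x : x \notin gverts v L -> {in P ++ Q, forall t', w t' x = x}.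
  move=> xL t'; rewrite (perm_mem pPQ) => /mapP[s sL ->].
  rewrite oL // cycle3E ?(grown_uniq gL) //.
  have : x \notin gtriple s by apply: contra xL; apply: gtriple_sub.
  by rewrite in_gtriple !negb_or => /and3P[/negbTE-> /negbTE-> /negbTE->].
set p1 := (\prod_(t <- P) w t)%g; set p2 := (\prod_(t <- Q) w t)%g.
have p1fix x : x \notin gverts v L -> p1 x = x.
  by move=> xL; apply: prod_perm_fix => t' t'P; apply: wfix;
    rewrite ?mem_cat ?t'P.
have p2fix x : x \notin gverts v L -> p2 x = x.
  by move=> xL; apply: prod_perm_fix => t' t'P; apply: wfix;
    rewrite ?mem_cat ?t'P ?orbT.
have prodE : (\prod_(t <- P ++ t :: Q) w t = p1 * cycle3 r a b * p2)%g.
  by rewrite big_cat big_cons /= mulgA -(oL' (r, (a, b))) ?mem_head.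
rewrite big_cat /= -/p1 -/p2 in cq; rewrite {}prodE.
have CE := cycle3E rab; move: (cycle3 r a b) CE => C CE.
(* [p1] carries [x0] to [r], where the new 3-cycle acts, so the block [a b] is inserted right after
   [x0]. *)
set x0 := (p1^-1)%g r.
have p1x0 : p1 x0 = r by rewrite permKV.
have x0q : x0 \in q.
  rewrite (perm_mem pq); apply: contraT => x0L.
  by have := p1fix _ x0L; rewrite p1x0 => r0; rewrite -r0 rL in x0L.
case/splitPr: x0q pq cq iq => q1 q2 pq cq iq.
have inq z : z \in q1 ++ x0 :: q2 -> z \in gverts v L by rewrite (perm_mem pq).
exists (q1 ++ [:: x0, a, b & q2]); split.
- apply/seq.permP=> S; move/seq.permP/(_ S): pq.
  by rewrite !count_cat /gverts /= -/(unroll (unzip2 L)); clear; lia.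
- apply: fcycle_insert cq _ _ _ _.
  + move=> z zq; rewrite !permM; congr (p2 _).
    have zL : z \in gverts v L.
      by apply: inq; rewrite mem_cat inE orbCA -mem_cat zq orbT.
    have pzL : p1 z \in gverts v L.
      apply: contraT => pzL; have /perm_inj pz := p1fix _ pzL.
      by rewrite pz zL in pzL.
    rewrite CE.
    case: eqP => [pr|_].
      have uq : uniq (q1 ++ x0 :: q2) by rewrite (perm_uniq pq) gverts_uniq.
      move: uq zq; rewrite uniq_catC cat_cons /= mem_cat orbC -mem_cat =>
        /andP[+ _].
      by have -> : z = x0; [apply: (@perm_inj _ p1);
        rewrite p1x0|move/negbTE->].
    case: eqP => [pa|_]; first by rewrite pa (negbTE aL) in pzL.
    by case: eqP => // pb; rewrite pb (negbTE bL) in pzL.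
  + by rewrite !permM p1x0 CE eqxx p2fix.
  + rewrite !permM (p1fix a) // CE eqxx.
    by move: rab; rewrite /= !inE negb_or -andbA => /and3P[+ _ _];
      rewrite eq_sym => /negbTE->; rewrite p2fix.
  + rewrite !permM (p1fix b) // CE eqxx p1x0.
    move: rab; rewrite /= !inE negb_or -andbA => /and4P[_ + + _].
    by rewrite ![_ == b]eq_sym => /negbTE-> /negbTE->.
(* On both sides the block is moved to the front, where its inversions depend only on which entries
   follow, not on their order. *)
- rewrite -cat_rcons inv_parity_insert; last 2 first.
  + by apply: contra aL => xq; apply: inq; rewrite -cat_rcons mem_cat xq.
  + by apply: contra bL => xq; apply: inq; rewrite -cat_rcons mem_cat xq.
  rewrite cat_rcons -[gverts _ _]/([:: v] ++ [:: a, b & unroll (unzip2 L)]).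
  rewrite inv_parity_insert; last 2 first.
  + by apply: contra aL; rewrite inE => /eqP->; apply: gverts_root.
  + by apply: contra bL; rewrite inE => /eqP->; apply: gverts_root.
  rewrite [LHS]/= [RHS]/= iq.
  have cnt y : count (ltn^~ y) (map val (q1 ++ x0 :: q2)) =
    count (ltn^~ y) (map val (gverts v L)).
    by apply/seq.permP; apply: perm_map.
  by rewrite !cnt.
Qed.

End TreeSign.

(** The witness sends [i] to the [i]-th entry of [q], so its one-line notation is [q] itself. *)
Lemma fcycle_notation N (v : 'I_N) (c : 'S_N) q :
  perm_eq q (enum 'I_N) -> fcycle c q ->
  exists2 s : 'S_N, cycle_notation c s & odd_perm s = inv_parity (map val q).
Proof.
move=> pq cq; have sq : size q = N by rewrite (perm_size pq) size_enum_ord.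
have uq : uniq q by rewrite (perm_uniq pq) enum_uniq.
pose f (i : 'I_N) := nth v q i.
have f_inj : injective f.
  move=> i j /eqP; rewrite nth_uniq ?sq // => /eqP ij; exact: val_inj.
exists (perm f_inj).
  apply/forallP=> i; rewrite !permE /f /=.
  have iq : nth v q i \in q by rewrite mem_nth ?sq.
  have := next_cycle cq iq => /eqP->; rewrite next_nth iq index_uniq ?sq //.
  case: q {pq cq uq f f_inj iq} sq => [|y q] /= sq; first by have := ltn_ord i;
    rewrite -[X in _ < X]sq.
  have := ltn_ord i; rewrite -[X in _ < X]sq ltnS leq_eqVlt => /predU1P[iE|iq].
    by rewrite iE nth_default // sq modnn.
  rewrite modn_small -?[X in _ < X]sq ?ltnS //=; exact/eqP/set_nth_default.
rewrite odd_perm_inv; congr inv_parity; apply: (@eq_from_nth _ 0).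
  by rewrite [LHS]size_map [RHS]size_map (perm_size pq).
move=> i; rewrite size_map -(perm_size pq) sq => iN.
rewrite [LHS](nth_map v) ?size_enum_ord // [RHS](nth_map v) ?sq //.
by rewrite permE /f nth_enum_ord.
Qed.

Section TreeSignFormula.

Variables (N : nat) (v : 'I_N).
Notation V := 'I_N.
Implicit Types (s : V * (V * V)) (L : seq (V * (V * V))) (w : {set V} -> 'S_N).

Lemma unroll_perm L : grown v L -> spans v L ->
  perm_eq (unroll (unzip2 L)) [seq x <- enum 'I_N | x != v].
Proof.
move=> gL fL; have /= /andP[vL uL] := gverts_uniq gL.
apply: uniq_perm => [//||x]; first by rewrite filter_uniq ?enum_uniq.
rewrite mem_filter mem_enum andbT; have := fL x; rewrite inE.
by case: (eqVneq x v) => [->|] //=; rewrite (negbTE vL).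
Qed.

Lemma gverts_perm L : grown v L -> spans v L ->
  perm_eq (gverts v L) (enum 'I_N).
Proof.
move=> gL fL; apply: uniq_perm; rewrite ?gverts_uniq ?enum_uniq // => x.
by rewrite fL mem_enum.
Qed.

Lemma gtriples_uniq L : grown v L -> uniq (map gtriple L).
Proof.
elim: L => [|[r [a b]] L IHL] // /and5P[_ aL _ _ gL] /=; rewrite IHL // andbT.
apply/mapP=> -[s sL tE]; case/negP: aL; apply: (gtriple_sub gL sL).
by rewrite -tE in_gtriple eqxx orbT.
Qed.

Lemma size_gverts L : size (gverts v L) = (size L).*2.+1.
Proof. by elim: L => //= -[r [a b]] L /= []->. Qed.

Lemma tree_sign_inv w L : grown v L -> spans v L -> oriented w L ->
  tree_sign w (gtriples L) = ((-1) ^+ inv_parity (map val (gverts v L)))%R.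
Proof.
move=> gL fL oL; have pL := gverts_perm gL fL.
(* Growth adds vertices to [v] two at a time; oddness is what [cycle_notation_odd] requires. *)
have oN : odd N.
  by rewrite -[N]size_enum_ord -(perm_size pL) size_gverts /= odd_double.
have pT : perm_eq [seq t <- index_enum _ | t \in gtriples L] (map gtriple L).
  apply: uniq_perm; rewrite ?filter_uniq ?index_enum_uniq ?gtriples_uniq // =>
    t.
  by rewrite mem_filter mem_index_enum andbT inE.
have [q [pq cq iq]] := tree_cycle gL oL pT.
have [s sc so] := fcycle_notation v (perm_trans pq pL) cq.
rewrite /tree_sign; case: pickP => [s'|/(_ s)];
  rewrite -big_filter ?sc // => s'c.
by rewrite -iq -so (cycle_notation_odd oN sc s'c).
Qed.

(** Since [(a r b) = (r b a)], a step with the opposite orientation is repaired by exchanging [a]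
    and [b], which alters neither its triple nor its pair. *)
Lemma reorient D w L : triple_orientation D w -> gtriples L \subset D ->
  grown v L ->
  exists L', [/\ grown v L', gverts v L' =i gverts v L,
    map gtriple L' = map gtriple L, map gpair L' = map gpair L & oriented w L'].
Proof.
move=> ow; elim: L => [|[r [a b]] L IHL]; first by exists [::].
rewrite gtriples_cons subUset sub1set => /andP[tD LD] gL'.
have rab := grown_uniq3 gL'; have /and5P[rL aL bL ab gL] := gL'.
have [L1 [gL1 vL1 tL1 pL1 oL1]] := IHL LD gL.
have := ow r a b rab tD; rewrite -[[set r; a; b]]/(gtriple (r, (a, b))).
case=> wt.
  exists ((r, (a, b)) :: L1); split; rewrite /= ?tL1 ?pL1 // ?vL1 ?rL ?aL ?bL
    ?ab //.
    by move=> x; rewrite !gverts_cons vL1.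
  by move=> s; rewrite inE => /predU1P[->|/oL1].
have tE : gtriple (r, (b, a)) = gtriple (r, (a, b)) by rewrite /gtriple /=
  setUAC.
exists ((r, (b, a)) :: L1); split; rewrite /= ?tL1 ?pL1 // ?vL1 ?rL ?aL ?bL
  1?eq_sym ?ab //.
- by move=> x; rewrite !gverts_cons vL1 orbCA.
- by rewrite tE.
- by rewrite /gpair /= setUC.
move=> s; rewrite inE => /predU1P[->|/oL1] //; rewrite tE wt /=.
rewrite cycle3_rot //; move: rab; rewrite /= !inE !negb_or !andbT.
by case/andP=> /andP[ra rb] ->; rewrite eq_sym ra rb.
Qed.

(** * Inversions, crossings and backward edges *)

Definition sort_pair (p : V * V) := if p.1 < p.2 then p else (p.2, p.1).

(** Asymmetric on purpose: [p] starts first, so a sum over ordered pairs counts each crossing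
    once. *)
Definition cross (p p' : V * V) : bool :=
  [&& p.1 < p'.1, p'.1 < p.2 & p.2 < p'.2].

Lemma sort_pairP L x : grown v L ->
  reflect (exists2 s, s \in L & x = sort_pair s.2)
          ((x.1 < x.2) && ([set x.1; x.2] \in gpairs L)).
Proof.
move=> gL; apply: (iffP andP) => [[x12]|[s sL ->]].
  rewrite inE => /mapP[s sL xE]; exists s => //.
  have : x.2 \in gpair s by rewrite -xE set22.
  have : x.1 \in gpair s by rewrite -xE set21.
  rewrite !inE /sort_pair; case: x x12 {xE} => a b /= ab.
  case: s {sL} => _ [c d] /= /orP[]/eqP aE /orP[]/eqP bE; subst.
  - by rewrite ltnn in ab.
  - by rewrite ab.
  - by rewrite ltnNge (ltnW ab).
  - by rewrite ltnn in ab.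
have [ab _ _] := grown_step_pair gL sL; rewrite /sort_pair inE.
have mL : gpair s \in map gpair L by apply: map_f.
case: (ltnP s.2.1 s.2.2) => /= [//|]; rewrite leq_eqVlt eq_sym => /orP[sE|lt];
  last first.
  by rewrite setUC; split.
by case/eqP: ab; apply/val_inj/eqP.
Qed.

Lemma sum_pairs L (F : V * V -> nat) : grown v L ->
  \sum_(x : V * V | (x.1 < x.2) && ([set x.1; x.2] \in gpairs L)) F x
  = \sum_(p <- unzip2 L) F (sort_pair p).
Proof.
move=> gL; rewrite big_map -(big_map (fun s => sort_pair s.2) xpredT).
rewrite big_uniq /=.
  by apply: eq_bigl => x; apply/sort_pairP/mapP.
rewrite map_inj_in_uniq ?(map_uniq (gtriples_uniq gL)) // => s s' sL s'L E.
have mem1 p : (sort_pair p).1 \in [set p.1; p.2].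
  by rewrite /sort_pair; case: ifP; rewrite !inE eqxx ?orbT.
by apply: (gpair_disjoint gL sL s'L (mem1 s.2)); rewrite E mem1.
Qed.

Lemma crossingsE L : grown v L -> crossings (gpairs L) =
  \sum_(p <- unzip2 L) \sum_(p' <- unzip2 L) cross (sort_pair p) (sort_pair p').
Proof.
move=> gL; rewrite -(sum_pairs (fun x =>
  \sum_(p' <- _) cross x (sort_pair p')) gL).
under eq_bigr do rewrite -(sum_pairs (fun x => cross _ x : nat) gL).
rewrite pair_big /= /crossings -sum1_card.
(* [crossings] groups the four endpoints by position, the double sum groups them by edge; [h]
   exchanges the groupings. *)
pose h (q : V * V * (V * V)) := ((q.1.1, q.2.1), (q.1.2, q.2.2)).
rewrite (reindex_inj (inv_inj (_ : involutive h))); last by case=> -[i k] [j l].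
rewrite big_mkcond [RHS]big_mkcond; apply: eq_bigr => -[[i k] [j l]] _.
rewrite inE /h /cross /=.
case: ([set i; k] \in _); case: ([set j; l] \in _); rewrite ?andbF ?andbT //.
case: (ltnP i j) => ij; case: (ltnP j k) => jk; case: (ltnP k l) => kl;
  rewrite /= ?if_same //.
by rewrite (ltn_trans ij jk) (ltn_trans jk kl).
Qed.

Lemma backwardE L (o : rel V) : grown v L -> backward_edges o (gpairs L) =
  \sum_(p <- unzip2 L) o (sort_pair p).2 (sort_pair p).1.
Proof.
move=> gL; rewrite -(sum_pairs (fun x => o x.2 x.1 : nat) gL).
rewrite /backward_edges -sum1_card big_mkcond [RHS]big_mkcond.
apply: eq_bigr => -[i j] _; rewrite inE /= andbA.
by case: ((i < j) && _) => //=; case: (o j i).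
Qed.

(** The left side holds when exactly one of [c], [d] lies between [a] and [b]. *)
Lemma cross_parity (a b c d : V) :
  a != b -> a != c -> a != d -> b != c -> b != d ->
  (c < a) (+) (d < a) (+) (c < b) (+) (d < b)
  = cross (sort_pair (a, b)) (sort_pair (c, d)) (+) cross (sort_pair (c, d))
    (sort_pair (a, b)).
Proof.
rewrite /cross /sort_pair -!val_eqE /= => ab ac ad bc bd.
case: (ltngtP a b) (ltngtP c d) (ltngtP a c) (ltngtP a d) (ltngtP b c) (ltngtP
  b d) => [?|?|?] [?|?|?] [?|?|?] [?|?|?] [?|?|?] [?|?|?] //=; lia.
Qed.

(* An earlier pair [a b] and a later pair [c d] of a sequence contribute an   *)
(* odd number of inversions exactly when the pairs cross.                     *)
Lemma inv_parity_crossings (ps : seq (V * V)) : uniq (unroll ps) ->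
  inv_parity (map val (unroll ps)) =
  odd (\sum_(p <- ps) \sum_(p' <- ps) cross (sort_pair p) (sort_pair p'))
  (+) odd (\sum_(p <- ps) (p.2 < p.1)).
Proof.
elim: ps => [|[a b] ps IHps]; first by rewrite !big_nil.
rewrite /= -/(unroll ps) inE negb_or => /and3P[/andP[ab aU] bU uU].
rewrite !big_cons.
have -> : \sum_(p <- ps) \sum_(p' <- (a, b) :: ps) cross (sort_pair p)
  (sort_pair p')
    = \sum_(p <- ps) cross (sort_pair p) (sort_pair (a, b))
      + \sum_(p <- ps) \sum_(p' <- ps) cross (sort_pair p) (sort_pair p').
  by rewrite -big_split /=; apply: eq_bigr => p _; rewrite big_cons.
have -> : cross (sort_pair (a, b)) (sort_pair (a, b)) =
  false by rewrite /cross ltnn.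
rewrite IHps // add0n !oddD !oddb.
suff : odd (count (ltn^~ (nat_of_ord a)) (map (@nat_of_ord N) (unroll ps)))
     (+) odd (count (ltn^~ (nat_of_ord b)) (map (@nat_of_ord N) (unroll ps)))
    = odd (\sum_(p <- ps) cross (sort_pair (a, b)) (sort_pair p))
      (+) odd (\sum_(p <- ps) cross (sort_pair p) (sort_pair (a, b))).
  move: (odd _) (odd _) (odd _) (odd _) (odd _) (odd _) (b < a).
  by do 7!case.
rewrite -!oddD -big_split /=.
elim: ps aU bU {IHps uU} => [|[c d] ps IHps]; first by rewrite big_nil.
rewrite /= -/(unroll ps) !inE !negb_or => /and3P[ac ad aU] /and3P[bc bd bU].
have := IHps aU bU; rewrite big_cons !oddD !oddb.
have := cross_parity ab ac ad bc bd.
move: (odd _) (odd _) (odd _) (cross _ _) (cross _ _) (c < a) (d < a) (c < b)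
  (d < b).
by do 9!case.
Qed.

End TreeSignFormula.

(** The orientation switched at [f] points from [p.1] to [p.2]. Without switching, the edge would be
    backward exactly when the pair is decreasing; each endpoint in [f] flips this. *)
Lemma backward_parity N (o : rel 'I_N) (f : pred 'I_N) (ps :
  seq ('I_N * 'I_N)) :
  (forall p, p \in ps -> [/\ p.1 != p.2, o p.1 p.2 (+) f p.1 (+) f p.2
                           & o p.2 p.1 = ~~ o p.1 p.2]) ->
  odd (\sum_(p <- ps) o (sort_pair p).2 (sort_pair p).1)
  = odd (\sum_(p <- ps) (p.2 < p.1)) (+) odd (count f (unroll ps)).
Proof.
elim: ps => [|[a b] ps IHps] ops; first by rewrite !big_nil.
rewrite !big_cons /= -/(unroll ps) !oddD !oddb IHps; last first.
  by move=> p pps; apply: ops; rewrite inE pps orbT.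
have [/= ab + oba] := ops (a, b) (mem_head _ _).
have -> : o (sort_pair (a, b)).2 (sort_pair (a, b)).1 = (b < a) (+) o b a.
  rewrite /sort_pair /=; case: ltngtP => //= [_|ba]; first by rewrite oba negbK.
  by case/eqP: ab; apply: val_inj.
rewrite oba; move: (o a b) (f a) (f b) (b < a) (odd _) (odd _).
by do 6!case.
Qed.

(** * Orientations *)

Section Pfaffian.

Variables (N : nat) (D : {set {set 'I_N}}) (v : 'I_N).
Notation V := 'I_N.
Notation G := (del_vertex (underlying_graph D) v).
Implicit Types (t : {set V}) (L : seq (V * (V * V))) (w : {set V} -> 'S_N) (o :
  rel V) (f : pred V).

Definition switch o f : rel V := [rel x y | o x y (+) f x (+) f y].

Definition follows w o f := forall t x, t \in D -> x \in t ->
  x != v -> w t x != v ->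
  switch o f x (w t x) /\ o (w t x) x = ~~ o x (w t x).

(** Inversions created by listing [v] first, plus the switched vertices other than [v]: a quantity
    independent of the tree. *)
Definition sign_offset f : nat :=
  let U := [seq x <- enum 'I_N | x != v] in
  count (ltn^~ v) (map val U) + count f U.

(** The inversion parity splits into inversions with [v], crossings, and decreasing pairs;
    [backward_parity] trades the last for backward edges and switched vertices. *)
Lemma tree_sign_matching w o f L' :
  triple_orientation D w -> follows w o f ->
  grown v L' -> spans v L' -> gtriples L' \subset D ->
  tree_sign w (gtriples L') =
    ((-1) ^+ sign_offset f *
     (matching_sign (gpairs L') * (-1) ^+ backward_edges o (gpairs L')))%R.
Proof.
move=> ow fw gL' fL' LD'.
have [L [gL vL tL pL oL]] := reorient ow LD' gL'.
have fL : spans v L by move=> x; rewrite vL fL'.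
have tE : gtriples L' = gtriples L by rewrite /gtriples tL.
have pE : gpairs L' = gpairs L by rewrite /gpairs pL.
rewrite tE in LD'; rewrite {}tE {}pE (tree_sign_inv gL fL oL).
have /= /andP[_ uU] := gverts_uniq gL; have pU := unroll_perm gL fL.
rewrite /matching_sign -(GRing.signr_odd _ (sign_offset f)).
rewrite -(GRing.signr_odd _ (crossings _)) -(GRing.signr_odd _ (backward_edges
  _ _)).
rewrite -!GRing.signr_addb; congr ((-1) ^+ _)%R; congr nat_of_bool.
rewrite (crossingsE gL) (backwardE _ gL) /= inv_parity_crossings //.
rewrite (@backward_parity _ _ f) => [|p]; last first.
  case/mapP=> s sL ->; have [ab va vb] := grown_step_pair gL sL.
  have wt := oL s sL; have := grown_uniq gL sL => us.
  have tD : gtriple s \in D by apply: (gtriple_in LD').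
  have wa : w (gtriple s) s.2.1 = s.2.2.
    rewrite wt cycle3E // eqxx; case: eqP => // E; move: us.
    by rewrite /= !inE E eqxx.
  have [|||] := fw _ s.2.1 tD _; rewrite ?wa 1?[_ == v]eq_sym //.
  by rewrite in_gtriple eqxx orbT.
rewrite /sign_offset oddD.
have -> : count (ltn^~ v) (map val [seq x <- enum 'I_N | x != v])
        = count (ltn^~ v) (map val (unroll (unzip2 L))).
  by apply/seq.permP/perm_map; rewrite perm_sym.
have -> : count f [seq x <- enum 'I_N | x != v] = count f (unroll (unzip2 L)).
  by apply/seq.permP; rewrite perm_sym.
move: (odd _) (odd _) (odd _) (odd _).
by do 4!case.
Qed.

(** [triple_orientation] quantifies over every enumeration of a triple, while a constructed
    orientation is known for one. *)
Lemma cycle3_cases (i j k i' j' k' : V) :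
  uniq [:: i; j; k] -> uniq [:: i'; j'; k'] -> [set i; j; k] = [set i'; j';
    k'] ->
  cycle3 i' j' k' = cycle3 i j k \/ cycle3 i' j' k' = cycle3 j i k.
Proof.
move=> ijk ijk' E.
have rot3 (x y z : V) : uniq [:: x; y; z] -> uniq [:: y; z; x].
  by rewrite -(rot_uniq 1).
have sw3 (x y z : V) : uniq [:: x; y; z] -> uniq [:: y; x; z].
  by rewrite /= !inE !negb_or !andbT eq_sym => /andP[/andP[-> ->] ->].
have r1 := cycle3_rot ijk; have r2 := cycle3_rot (rot3 _ _ _ ijk).
have s1 := cycle3_rot (sw3 _ _ _ ijk).
have s2 := cycle3_rot (rot3 _ _ _ (sw3 _ _ _ ijk)).
have mi : i' \in [set i; j; k] by rewrite E !inE eqxx.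
have mj : j' \in [set i; j; k] by rewrite E !inE eqxx orbT.
have mk : k' \in [set i; j; k] by rewrite E !inE eqxx orbT.
move: mi mj mk ijk'; rewrite !inE -!orbA.
case/or3P=> /eqP-> /or3P[]/eqP-> /or3P[]/eqP->;
  rewrite /= !inE ?eqxx ?orbT /= ?andbF //= => _.
- by left.
- by right; rewrite s1.
- by right.
- by left; rewrite r1.
- by left; rewrite r1 r2.
- by right; rewrite s1 s2.
Qed.

Lemma cycle3_values (i j k : V) : uniq [:: i; j; k] ->
  [/\ cycle3 i j k i = j, cycle3 i j k j = k & cycle3 i j k k = i].
Proof.
move=> ijk; rewrite !cycle3E // !eqxx.
move: ijk; rewrite /= !inE !negb_or !andbT => /andP[/andP[ij ik] jk].
by rewrite ![_ == i]eq_sym (negbTE ij) (negbTE ik) eq_sym (negbTE jk).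
Qed.

Section Orientation.

Hypothesis hD : partial_steiner D.
Variable w : {set V} -> 'S_N.
Hypothesis ow : triple_orientation D w.

Lemma orientationP t : t \in D ->
  exists i j k, [/\ uniq [:: i; j; k], t = [set i; j; k] & w t = cycle3 i j k].
Proof.
move=> tD; have t3 := card_triple hD tD.
have /card_gt1P[i [j [it jt ij]]] : 1 < #|t| by rewrite t3.
have [k [ki kj tE]] := card3E t3 it jt ij.
have ijk : uniq [:: i; j; k] by rewrite /= !inE negb_or ij eq_sym ki eq_sym kj.
have ijkD : [set i; j; k] \in D by rewrite -tE.
have [] := ow ijk ijkD; rewrite -tE => wt.
  by exists i, j, k.
exists j, i, k; split=> //; last by rewrite tE [[set i; j]]setUC.
by move: ijk; rewrite /= !inE !negb_or !andbT eq_sym => /andP[/andP[-> ->] ->].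
Qed.

Lemma orientation_antisym t x y : t \in D -> x \in t -> y \in t -> x != y ->
  (w t x == y) = ~~ (w t y == x).
Proof.
move=> /orientationP[i [j [k [ijk -> ->]]]]; rewrite !cycle3E //.
move: ijk; rewrite /= !inE !negb_or !andbT => /andP[/andP[ij ik] jk].
have [ji ki kj] : [/\ j != i, k != i & k != j] by split; rewrite eq_sym.
rewrite -!orbA => /or3P[]/eqP-> /or3P[]/eqP->; rewrite ?eqxx // => _;
  by rewrite ?(negbTE ij, negbTE ik, negbTE jk, negbTE ji, negbTE ki, negbTE
    kj, eqxx).
Qed.

Lemma orientation_moves t x : t \in D -> x \in t -> w t x \in t /\ x != w t x.
Proof.
move=> /orientationP[i [j [k [ijk -> ->]]]]; rewrite !cycle3E //.
move: ijk; rewrite /= !inE !negb_or !andbT => /andP[/andP[ij ik] jk].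
have [ji ki kj] : [/\ j != i, k != i & k != j] by split; rewrite eq_sym.
rewrite -!orbA => /or3P[]/eqP->;
  by rewrite ?(negbTE ij, negbTE ik, negbTE jk, negbTE ji, negbTE ki, negbTE
    kj, eqxx, orbT).
Qed.

(** In a partial Steiner system an edge has a single triple, so no two cyclic orders compete for its
    direction. *)
Definition induced_orientation : rel V :=
  [rel x y | [exists t in D, [&& x \in t, y \in t & w t x == y]]].

Lemma induced_orientationE t x y : t \in D -> x \in t -> y \in t -> x != y ->
  induced_orientation x y = (w t x == y).
Proof.
move=> tD xt yt xy; apply/exists_inP/idP => [[t' t'D /and3P[xt' yt']]|wt].
  by have [_ uD] := hD; rewrite (uD x y t t').
by exists t; rewrite ?xt ?yt.
Qed.

Lemma induced_edge_orientation : edge_orientation G induced_orientation.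
Proof.
move=> x y; rewrite in_edges cards2 => /and3P[_ xy /exists_inP[t tD]].
have {}xy : x != y by case: (x != y) xy.
rewrite subUset !sub1set => /andP[xt yt].
have yx : y != x by rewrite eq_sym.
rewrite (induced_orientationE tD xt yt xy) (induced_orientationE tD yt xt yx).
exact: orientation_antisym.
Qed.

Lemma follows_induced : follows w induced_orientation pred0.
Proof.
move=> t x tD xt _ _; have [wxt xw] := orientation_moves tD xt.
have wx : w t x != x by rewrite eq_sym.
rewrite /switch /= !addbF (induced_orientationE tD xt wxt xw) eqxx; split=> //.
rewrite (induced_orientationE tD wxt xt wx).
by rewrite (orientation_antisym tD wxt xt wx) eqxx.
Qed.

End Orientation.

(* Switching at a vertex of a triangle reverses two of its edges, so one of   *)
(* the two cyclic orientations can be reached; vertices of [t] lie in         *)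
(* distinct components of [F :\ t], and switching a whole component does not  *)
(* affect the triangles already made cyclic.                                  *)
Lemma cyclic_switching o (F : {set {set V}}) :
  hacyclic F -> (forall t, t \in F -> #|t| = 3) ->
  (forall t x y, t \in F -> x \in t -> y \in t -> x != y -> o x y = ~~ o y x) ->
  exists f, forall t, t \in F -> exists i j k,
    [/\ uniq [:: i; j; k], t = [set i; j; k],
        switch o f i j, switch o f j k & switch o f k i].
Proof.
elim: {F}#|F| {-2}F (erefl #|F|) => [|n IHn] F cF acF F3 oF.
  by exists pred0 => t; rewrite (cards0_eq cF) inE.
have /card_gt0P[t tF] : 0 < #|F| by rewrite cF.
have sF : F :\ t \subset F := subsetDl _ _.
have [||||f0 f0P] := IHn (F :\ t).
- by have := cardsD1 t F; rewrite cF tF => -[].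
- exact: hacyclicS acF.
- by move=> t' /(subsetP sF); apply: F3.
- by move=> t' x y /(subsetP sF); apply: oF.
have t3 := F3 t tF.
have /card_gt1P[i [j [it jt ij]]] : 1 < #|t| by rewrite t3.
have [k [ki kj tE]] := card3E t3 it jt ij.
have kt : k \in t by rewrite tE !inE eqxx orbT.
have [ik jk] : i != k /\ j != k by rewrite eq_sym ki eq_sym kj.
pose e := hadj (F :\ t).
have nc x y : x \in t -> y \in t -> x != y -> connect e x y = false.
  move=> xt yt; apply: contraNF => c; apply/eqP.
  by move/hacyclicE: acF => /(_ t x y tF xt yt c).
pose u a b := switch o f0 a b.
(* These switches give [i j], [j k] and [k i] the common value [u i j (+) u j k (+) u k i], so the
   triangle becomes cyclic in one sense or the other. *)
pose f x := f0 x (+) (connect e j x && (u j k (+) u k i))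
                 (+) (connect e k x && (u i j (+) u j k)).
have fi : f i = f0 i by rewrite /f !nc 1?eq_sym // !addbF.
have fj : f j = f0 j (+) (u j k (+) u k i).
  by rewrite /f connect0 (nc k j) // addbF.
have fk : f k = f0 k (+) (u i j (+) u j k).
  by rewrite /f connect0 (nc j k) // addbF.
exists f => t' t'F; case: (eqVneq t' t) => [{t' t'F}->|t't].
  have oij := oF t i j tF it jt ij; have ojk := oF t j k tF jt kt jk.
  have oki := oF t k i tF kt it ki.
  case E : (u i j (+) u j k (+) u k i); [exists i, j, k|exists j, i, k].
    split; rewrite ?tE /= ?inE ?negb_or ?ij ?ik ?jk //.
    - rewrite /switch /= fi fj; move: E; rewrite /u /switch /=.
      by move: (o i j) (o j k) (o k i) (f0 i) (f0 j) (f0 k); do 6!case.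
    - rewrite /switch /= fk fj; move: E; rewrite /u /switch /=.
      by move: (o i j) (o j k) (o k i) (f0 i) (f0 j) (f0 k); do 6!case.
    - rewrite /switch /= fi fk; move: E; rewrite /u /switch /=.
      by move: (o i j) (o j k) (o k i) (f0 i) (f0 j) (f0 k); do 6!case.
  split; rewrite /= ?inE ?negb_or ?ik ?jk 1?eq_sym ?ij //.
  - by rewrite tE [[set i; j]]setUC.
  - rewrite /switch /= fi fj; move: E; rewrite /u /switch /= oij.
    by move: (o j i) (o j k) (o k i) (f0 i) (f0 j) (f0 k); do 6!case.
  - rewrite /switch /= fi fk; move: E; rewrite /u /switch /= oki.
    by move: (o i j) (o j k) (o i k) (f0 i) (f0 j) (f0 k); do 6!case.
  - rewrite /switch /= fk fj; move: E; rewrite /u /switch /= ojk.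
    by move: (o i j) (o k j) (o k i) (f0 i) (f0 j) (f0 k); do 6!case.
have t'F1 : t' \in F :\ t by rewrite in_setD1 t't.
have [i' [j' [k' [u' t'E s1 s2 s3]]]] := f0P t' t'F1.
exists i', j', k'.
(* The vertices of [t'] lie in one component of [F :\ t], so the added switch is constant on [t']
   and cancels along its edges. *)
have fE x y : x \in t' -> y \in t' -> switch o f x y = switch o f0 x y.
  move=> xt yt; have cE z : connect e z x = connect e z y.
    exact: (same_connect_r (@connect_hadjC _ _) (connect_hadj1 t'F1 xt yt)).
  rewrite /switch /f /= !cE; case: (connect e j y && _);
    case: (connect e k y && _);
  by case: (o x y); case: (f0 x); case: (f0 y).
by rewrite !fE // t'E !inE eqxx ?orbT.
Qed.

(** * The equivalence of the two Pfaffian properties *)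

Hypothesis hD : partial_steiner D.
Hypothesis hv : hacyclic [set t in D | v \notin t].

Lemma pfaffian_of_three_pfaffian : three_pfaffian D -> pfaffian G.
Proof.
case=> w [ow cw]; exists (induced_orientation w); split.
  exact: induced_edge_orientation.
move=> M1 M2 /(matching_grown hD hv)[L1 [gL1 fL1 LD1 <-]].
move=> /(matching_grown hD hv)[L2 [gL2 fL2 LD2 <-]].
have := cw _ _ (grown_spanning gL1 fL1 LD1) (grown_spanning gL2 fL2 LD2).
have fw := follows_induced hD ow.
rewrite !(tree_sign_matching ow fw) //; apply: GRing.mulfI.
by rewrite GRing.signr_eq0.
Qed.

(** Triples avoiding [v] are made cyclic by [cyclic_switching]. A triple through [v] has one edge in
    G - v, and one of its two cyclic orders follows the switched direction of that edge. *)
Lemma three_pfaffian_of_pfaffian : pfaffian G -> three_pfaffian D.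
Proof.
case=> o [oo co]; pose F := [set t in D | v \notin t].
have oD t x y : t \in D -> x \in t -> y \in t -> x != y -> x != v -> y != v ->
    o x y = ~~ o y x.
  move=> tD xt yt xy xv yv; apply: oo; rewrite in_edges cards2 xy !inE negb_or.
  rewrite !(eq_sym v) xv yv; apply/exists_inP; exists t => //.
  by rewrite subUset !sub1set xt.
have [||f fP] := @cyclic_switching o F hv.
- by move=> t; rewrite inE => /andP[/(card_triple hD)].
- move=> t x y; rewrite inE => /andP[tD vt] xt yt xy; apply: (oD t) => //.
    by apply: contraNneq vt => <-.
  by apply: contraNneq vt => <-.
pose coherent t (s : 'S_N) :=
  [forall x in t, (x != v) ==> (s x != v) ==> switch o f x (s x)].
pose good t (s : 'S_N) := [exists p : V * V * V,
  [&& uniq [:: p.1.1; p.1.2; p.2], t == [set p.1.1; p.1.2; p.2]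
    & s == cycle3 p.1.1 p.1.2 p.2]] && coherent t s.
(* By [wP] the default is never reached on [D]. *)
pose w t := odflt 1%g [pick s | good t s].
have wP t : t \in D -> good t (w t).
  move=> tD; rewrite /w; case: pickP => //= none; exfalso.
  suff [i [j [k [ijk tE ch]]]] : exists i j k,
      [/\ uniq [:: i; j; k], t = [set i; j; k] & coherent t (cycle3 i j k)].
    have /negP[] := none (cycle3 i j k); rewrite /good ch andbT.
    by apply/existsP; exists (i, j, k); rewrite ijk tE !eqxx.
  case: (boolP (v \in t)) => vt; last first.
    have [|i [j [k [ijk tE oij ojk oki]]]] := fP t; first by rewrite inE tD.
    exists i, j, k; split=> //; have [ci cj ck] := cycle3_values ijk.
    apply/forall_inP=> x xt; do 2!apply/implyP=> _; move: xt.
    by rewrite tE !inE -orbA => /or3P[]/eqP->; rewrite ?ci ?cj ?ck.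
  have [a at_ av] : exists2 a, a \in t & a != v.
    have /card_gt1P[i [j [it jt ij]]] : 1 < #|t| by rewrite (card_triple hD).
    by case: (eqVneq i v) => [iv|iv]; [exists j;
      rewrite // -iv eq_sym | exists i].
  have va : v != a by rewrite eq_sym.
  have [b [bv ba tE]] := card3E (card_triple hD tD) vt at_ va.
  have bt : b \in t by rewrite tE !inE eqxx orbT.
  have ab : a != b by rewrite eq_sym.
  have vb : v != b by rewrite eq_sym.
  have coh c d : uniq [:: v; c; d] -> t = [set v; c; d] -> switch o f c d ->
      coherent t (cycle3 v c d).
    move=> vcd tE' ocd; have [cv cc cd] := cycle3_values vcd.
    apply/forall_inP=> x xt; apply/implyP=> xv; apply/implyP; move: xt xv.
    by rewrite tE' !inE -orbA => /or3P[]/eqP->; rewrite ?cv ?cc ?cd ?eqxx.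
  case ocd : (switch o f a b).
    by exists v, a, b; split=> //; [rewrite /= !inE negb_or va vb ab | apply:
      coh; rewrite //= !inE negb_or va vb ab].
  have tE' : t = [set v; b; a] by rewrite setUAC.
  have vba : uniq [:: v; b; a] by rewrite /= !inE negb_or va vb ba.
  exists v, b, a; split=> //; apply: coh => //.
  move/negbT: ocd; rewrite /switch /= (oD t) //.
  by case: (o b a); case: (f a); case: (f b).
have ow : triple_orientation D w.
  move=> i j k ijk ijkD; have /andP[/existsP[p /and3P[up /eqP tE /eqP->]] _]
    := wP _ ijkD.
  exact: cycle3_cases.
exists w; split=> // T1 T2 sT1 sT2.
have [L1 [gL1 fL1 LT1]] := spanning_grown v (proj1 hD) sT1.
have [L2 [gL2 fL2 LT2]] := spanning_grown v (proj1 hD) sT2.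
have LD1 : gtriples L1 \subset D by rewrite LT1; case/andP: sT1.
have LD2 : gtriples L2 \subset D by rewrite LT2; case/andP: sT2.
have fw : follows w o f.
  move=> t x tD xt xv wxv; have [wxt xw] := orientation_moves hD ow tD xt.
  have /andP[_ /forall_inP/(_ x xt)] := wP t tD; rewrite xv wxv; split=> //.
  by apply: (oD t) => //; rewrite eq_sym.
rewrite -LT1 -LT2 !(tree_sign_matching ow fw) //; congr (_ * _)%R.
by apply: co; apply: gpairs_matching.
Qed.

End Pfaffian.

Theorem theorem6p2 (N : nat) (D : {set {set 'I_N}}) (v : 'I_N)
    (hD : partial_steiner D)
    (hv : hacyclic [set t in D | v \notin t]) :
  #|[set T : {set {set 'I_N}} | spanning_tree D T]| =
    #|[set M : {set {set 'I_N}} |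
         perfect_matching (del_vertex (underlying_graph D) v) M]| /\
  (three_pfaffian D <-> pfaffian (del_vertex (underlying_graph D) v)).
Proof.
split; first exact: card_spanning_trees.
split; [exact: pfaffian_of_three_pfaffian | exact: three_pfaffian_of_pfaffian].
Qed.
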